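(* Let $J:\mathbb{R}^n\to[0,\infty)$ be convex, lower semicontinuous and absolutely one-homogeneous, and let $f\in\mathbb{R}^n$. The function $u_{GF}:[0,\infty)\to\mathbb{R}^n$ is Lipschitz continuous. Moreover, the spectral representation satisfies $\phi_{GF}\in\big(W^{1,1}_{loc}([0,\infty);\mathbb{R}^n)\big)^*$, i.e. $\phi_{GF}$ is a well-defined continuous linear functional on $W^{1,1}_{loc}([0,\infty);\mathbb{R}^n)$.
   Context: Absolutely one-homogeneous means $J(su)=|s|J(u)$ for all $s\in\mathbb{R}$, $u\in\mathbb{R}^n$. $u_{GF}:[0,\infty)\to\mathbb{R}^n$ is the (locally absolutely continuous) solution of the gradient flow $\partial_t u_{GF}(t)=-p_{GF}(t)$, $p_{GF}(t)\in\partial J(u_{GF}(t))$ for a.e. $t>0$, $u_{GF}(0)=f$, with $\partial J$ the convex subdifferential; $u_{GF}(t)$ is constant for all large $t$. The spectral (wavelength) representation is $\phi_{GF}(t)=t\,\partial_{tt}u_{GF}(t)$ in the distributional sense, i.e. it acts on test functions $v$ by $$ v\mapsto -\int_0^\infty \big(t\,\partial_t v(t)+v(t)\big)\cdot\partial_t u_{GF}(t)\,dt. $$ $W^{1,1}_{loc}([0,\infty);\mathbb{R}^n)$ is the space of functions belonging to $W^{1,1}((0,T);\mathbb{R}^n)$ for every $T<\infty$, with the topology given by these seminorms. *)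

(* Defs.v *)
From HB Require Import structures.
From mathcomp Require Import all_boot all_order all_algebra.
From mathcomp Require Import all_classical all_reals all_analysis.

Set Implicit Arguments.
Unset Strict Implicit.
Unset Printing Implicit Defensive.

Import Order.TTheory GRing.Theory Num.Theory.
Import numFieldNormedType.Exports.

Local Open Scope classical_set_scope.
Local Open Scope ring_scope.

(* R^n is 'rV[R]_n. The Euclidean structure enters only through dotv; the
   library norm `|x| is the max norm, and it is used only in notions
   (limits, absolute continuity, Lipschitz continuity, the topology of
   W^{1,1}_loc) that are the same for all norms on R^n.
   A function on [0, +oo[ is represented by a function on R of which only the
   restriction to [0, +oo[ matters. *)

Definition dotv (R : realType) (n : nat) (x y : 'rV[R]_n) : R :=
  \sum_(i < n) x ord0 i * y ord0 i.

Definition abs_one_homogeneous (R : realType) (n : nat) (J : 'rV[R]_n -> R) :=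
  forall (s : R) (x : 'rV[R]_n), J (s *: x) = `|s| * J x.

Definition subdifferential (R : realType) (n : nat) (J : 'rV[R]_n -> R)
    (x : 'rV[R]_n) : set 'rV[R]_n :=
  [set p | forall y, J x + dotv p (y - x) <= J y].

Definition abs_continuous_on (R : realType) (n : nat) (a b : R)
    (u : R -> 'rV[R]_n) :=
  forall e : R, 0 < e -> exists2 d : R, 0 < d &
    forall (m : nat) (x y : 'I_m -> R),
      (forall i, a <= x i /\ x i <= y i /\ y i <= b) ->
      (forall i j, i != j -> y i <= x j \/ y j <= x i) ->
      \sum_(i < m) (y i - x i) < d ->
      \sum_(i < m) `|u (y i) - u (x i)| < e.

Definition gradient_flow (R : realType) (n : nat) (J : 'rV[R]_n -> R)
    (f : 'rV[R]_n) (u : R -> 'rV[R]_n) :=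
  [/\ forall T : R, 0 < T -> abs_continuous_on 0 T u,
      u 0 = f &
      exists p : R -> 'rV[R]_n,
        {ae (@lebesgue_measure R), forall t : R, 0 < t ->
           is_derive t 1 u (- p t) /\ subdifferential J (u t) (p t)}].

(* C_c^oo(]0, T[) *)
Definition test_function (R : realType) (T : R) (h : R -> R) :=
  (forall (k : nat) (x : R), derivable (derive1n k h) x 1) /\
  exists a b : R, [/\ 0 < a, a <= b, b < T &
    forall x, x \notin `[a, b] -> h x = 0].

(* v is in L^1(]0, T[; R^n) and has the weak derivative dv there, with dv also
   in L^1. Integrability includes Borel measurability, which is no loss:
   each Lebesgue class contains a Borel function. *)
Definition weak_derivative_on (R : realType) (n : nat) (T : R)
    (v dv : R -> 'rV[R]_n) :=
  forall i : 'I_n,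
    [/\ (@lebesgue_measure R).-integrable `]0, T[
          (EFin \o (fun t => v t ord0 i)),
        (@lebesgue_measure R).-integrable `]0, T[
          (EFin \o (fun t => dv t ord0 i)) &
        forall h, test_function T h ->
          \int[@lebesgue_measure R]_(t in `]0, T[) (v t ord0 i * derive1 h t) =
          - \int[@lebesgue_measure R]_(t in `]0, T[) (dv t ord0 i * h t)].

Definition W11 (R : realType) (n : nat) (T : R) (v : R -> 'rV[R]_n) :=
  exists dv, weak_derivative_on T v dv.

Definition W11loc (R : realType) (n : nat) (v : R -> 'rV[R]_n) :=
  forall T : R, 0 < T -> W11 T v.

Definition weak_derivative (R : realType) (n : nat) (v dv : R -> 'rV[R]_n) :=
  forall T : R, 0 < T -> weak_derivative_on T v dv.

(* A choice of weak derivative, unique up to null sets in [0, +oo[. *)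
Definition wderiv (R : realType) (n : nat) (v : R -> 'rV[R]_n) :
    R -> 'rV[R]_n :=
  xget (fun=> 0) (weak_derivative v).

Definition W11_seminorm (R : realType) (n : nat) (T : R)
    (v : R -> 'rV[R]_n) : R :=
  \int[@lebesgue_measure R]_(t in `]0, T[) (`|v t| + `|wderiv v t|).

(* F is a continuous linear functional on W^{1,1}_loc. The elements of the
   space are classes modulo a.e. equality, so F must respect it; the finite
   intersections of seminorm balls at v form a neighbourhood base of v. *)
Definition W11loc_dual (R : realType) (n : nat)
    (F : (R -> 'rV[R]_n) -> R) :=
  [/\ forall v w, W11loc v -> W11loc w ->
        {ae (@lebesgue_measure R), forall t : R, 0 < t -> v t = w t} ->
        F v = F w,
      forall (a : R) v w, W11loc v -> W11loc w ->
        F (fun t => a *: v t + w t) = a * F v + F w &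
      forall v, W11loc v -> forall e : R, 0 < e ->
        exists (Ts : seq R) (d : R),
          [/\ 0 < d, forall T, T \in Ts -> 0 < T &
            forall w, W11loc w ->
              (forall T, T \in Ts ->
                W11_seminorm T (fun t => w t - v t) < d) ->
              `|F w - F v| < e]].

Definition spectral_integrand (R : realType) (n : nat)
    (u v dv : R -> 'rV[R]_n) (t : R) : R :=
  dotv (t *: dv t + v t) (derive1 u t).

Definition spectral_representation (R : realType) (n : nat)
    (u : R -> 'rV[R]_n) (v : R -> 'rV[R]_n) : R :=
  - \int[@lebesgue_measure R]_(t in `[0, +oo[)
      spectral_integrand u v (wderiv v) t.

(* The defining integral of the spectral representation makes sense on
   W^{1,1}_loc and depends on no choice of weak derivative. *)
Definition spectral_representation_well_defined (R : realType) (n : nat)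
    (u : R -> 'rV[R]_n) :=
  forall v : R -> 'rV[R]_n, W11loc v ->
    (exists dv, weak_derivative v dv) /\
    forall dv, weak_derivative v dv ->
      (@lebesgue_measure R).-integrable `[0, +oo[
        (EFin \o spectral_integrand u v dv) /\
      spectral_representation u v =
        - \int[@lebesgue_measure R]_(t in `[0, +oo[)
            spectral_integrand u v dv t.

(* Main.v *)
Require Import Defs.
From HB Require Import structures.
From mathcomp Require Import all_boot all_order all_algebra.
From mathcomp Require Import all_classical all_reals all_analysis.
From mathcomp Require Import measurable_realfun lra ring.

Set Implicit Arguments.
Unset Strict Implicit.
Unset Printing Implicit Defensive.

Import Order.TTheory GRing.Theory Num.Theory.
Import numFieldNormedType.Exports.

Local Open Scope classical_set_scope.
Local Open Scope ring_scope.

(** A convex, absolutely one-homogeneous [J] with finite values is a seminorm,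
    so a subgradient [p] at [x] satisfies [p . y <= J y] for every [y] and
    [p . x = J x].  Everything follows from these two facts.

    Lipschitz continuity.  Subgradients are bounded by a constant depending on
    [J] only, hence so is the derivative of the flow wherever it exists.  An
    absolutely continuous function whose derivative is a.e. at most [C]
    increases at rate at most [C] ([ae_derivative_le]); this is proved by a
    covering argument on the line, without integrating the derivative.

    Finite extinction.  The integral that defines the spectral representation
    runs over a half-line on which the test function is only locally
    integrable; it converges because the flow stops.  Let [N] be the kernel of
    [J] and [a] the point of [N] closest to the datum.  Subgradients are
    orthogonal to [N], so [w = u - a] stays in the orthogonal complement of
    [N], where [J w >= c |w|] with [c > 0] by compactness of the unit sphere
    ([seminorm_coercive]).  Since the derivative of [|w|^2] is
    [- 2 p . u = - 2 J w], the Euclidean norm of [w] decreases at least at a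
    fixed positive rate until it vanishes ([flow_extinction]).

    The functional.  From then on everything takes place on an interval
    ]0, S[, where the integrand is at most a constant times [|v| + |v'|];
    this gives integrability and continuity for the seminorm of [W11] at once
    ([spectral_integral_bound]).  Two points need care.  First, integrability
    asks for Borel measurability of the pointwise derivative of [u], including
    its conventional value where [u] is not differentiable: the set of
    differentiability of a continuous function is a countable intersection of
    countable unions of closed sets ([derivable_setE]).  Second, an element of
    [W11loc] has one weak derivative on each ]0, T[, and these have to be glued
    into one on the half-line; this, and the independence of the functional
    from the choice of weak derivative, rest on the lemma of du Bois-Reymond.
    It is obtained from smooth bumps [bump a b m], built from
    [exp (- 1 / x)], that increase to the indicator of ]a, b[: an integrable
    function orthogonal to all of them has zero integral on each interval, so
    it vanishes a.e. by the differentiation theorem ([du_bois_reymond]). *)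

Local Notation mu := (@lebesgue_measure _).

(** * Absolutely continuous functions with a bounded derivative *)

(** The scalar form of [abs_continuous_on]. *)
Definition real_abs_continuous (R : realType) (a b : R) (g : R -> R) :=
  forall e : R, 0 < e -> exists2 d : R, 0 < d &
    forall (m : nat) (x y : 'I_m -> R),
      (forall i, a <= x i /\ x i <= y i /\ y i <= b) ->
      (forall i j, i != j -> y i <= x j \/ y j <= x i) ->
      \sum_(i < m) (y i - x i) < d ->
      \sum_(i < m) `|g (y i) - g (x i)| < e.

(** Cousin's lemma, read as an induction principle on [a, b]: a property that
    passes from the left to the right of every point, over small enough
    intervals around it, reaches [b].  Otherwise the supremum of the points
    that it reaches could be passed. *)
Lemma straddle_induction (R : realType) (a b : R) (P : R -> Prop) :
  a <= b -> P a ->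
  (forall c, a <= c <= b -> exists2 r, 0 < r & forall y z,
     a <= y -> c - r < y -> y <= c -> c <= z -> z < c + r -> z <= b ->
     P y -> P z) ->
  P b.
Proof.
move=> ab Pa step; pose S := [set y | a <= y <= b /\ P y].
have Sa : S a by rewrite /S/= lexx ab.
have ubS : ubound S b by move=> y [/andP[]].
have hS : has_sup S by split; [exists a | exists b].
have [cb ac] : sup S <= b /\ a <= sup S.
  by split; [apply: ge_sup => //; exists a | apply: ub_le_sup => //; exists b].
have [|r r0 stp] := step (sup S); first by rewrite ac cb.
have [y [/andP[ay yb] Py] ry] := sup_adherent r0 hS.
have yc : y <= sup S by apply: ub_le_sup; [exists b | split=> //;
  rewrite ay yb].
pose z := Num.min (sup S + r / 2) b.
have cz : sup S <= z by rewrite le_min cb andbT; lra.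
have zr : z < sup S + r by rewrite gt_min; apply/orP; left; lra.
have zb : z <= b by rewrite ge_min lexx orbT.
have Pz := stp y z ay ry yc cz zr zb Py.
have Sz : S z by split=> //; rewrite zb andbT (le_trans ac).
have zc : z <= sup S by apply: ub_le_sup => //; exists b.
suff : z = b by move=> <-.
move: zc; rewrite /z; have [h zc|//] := leP (sup S + r / 2) b.
exfalso; lra.
Qed.

(** The two points are on either side of [c], and not only one of them equal
    to [c]: the intervals met in [straddle_induction] are of this kind. *)
Lemma is_derive_straddle (R : realType) (g : R -> R) (c d e : R) :
  is_derive c 1 g d -> 0 < e ->
  exists2 r, 0 < r & forall y z, c - r < y -> y <= c -> c <= z -> z < c + r ->
    g z - g y <= (d + e) * (z - y).
Proof.
move=> [dg dE] e0.
have /cvgrPdist_lt/(_ e e0) : h^-1 *: (g (h + c) - g c) @[h --> 0^'] --> d.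
  rewrite -dE; have := dg; rewrite /derivable /derive.
  under eq_fun do rewrite scaler1; by [].
move=> /nbhs_ballP[r/= r0 Hr].
have H h : h != 0 -> `|h| < r -> `|d - h^-1 * (g (h + c) - g c)| < e.
  by move=> h0 hr; apply: (Hr h) => //; rewrite /ball/= sub0r normrN.
exists r => // y z ry yc cz zr.
have up : g z - g c <= (d + e) * (z - c).
  have [->|zc] := eqVneq z c; first by rewrite !subrr mulr0.
  have zc0 : 0 < z - c by rewrite subr_gt0 lt_neqAle eq_sym zc.
  have := H (z - c); rewrite subr_eq0 zc subrK gtr0_norm// => /(_ isT).
  have -> : z - c < r by lra.
  move=> /(_ isT); rewrite ltr_norml => /andP[dq _].
  have : (z - c)^-1 * (g z - g c) <= d + e by lra.
  by rewrite mulrC ler_pdivrMr.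
have dn : g c - g y <= (d + e) * (c - y).
  have [->|yc'] := eqVneq y c; first by rewrite !subrr mulr0.
  have yc0 : y - c < 0 by rewrite subr_lt0 lt_neqAle yc' yc.
  have := H (y - c); rewrite subr_eq0 yc' subrK ltr0_norm// => /(_ isT).
  have -> : - (y - c) < r by lra.
  move=> /(_ isT); rewrite ltr_norml => /andP[dq _].
  have : (y - c)^-1 * (g y - g c) <= d + e by lra.
  by rewrite mulrC ler_ndivrMr// => dy; lra.
lra.
Qed.

(** Cover the exceptional null set by an open set [U] so small that, by
    absolute continuity, [g] changes by less than [e] over disjoint intervals
    inside [U].  Straddling intervals around the other points increase [g] at
    rate at most [C + e]; [straddle_induction] lines up intervals of both
    kinds from [a] to [b]. *)
Lemma ae_derivative_le (R : realType) (a b C : R) (g : R -> R) (Z : set R) :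
  a <= b -> real_abs_continuous a b g ->
  (@lebesgue_measure R).-negligible Z ->
  (forall t, a < t < b -> ~ Z t -> exists2 d, is_derive t 1 g d & d <= C) ->
  g b - g a <= C * (b - a).
Proof.
move=> ab acg Z0 dg.
suff H e : 0 < e -> g b - g a <= (C + e) * (b - a) + 2 * e.
  apply/ler_addgt0Pr => e e0.
  have k0 : 0 < b - a + 2 by lra.
  have := H (e / (b - a + 2)) (divr_gt0 e0 k0).
  have : e = e / (b - a + 2) * (b - a + 2) by rewrite divfK// gt_eqF.
  by set e' := e / _ => -> ?; lra.
move=> e0; pose K := C + e; have [d d0 Hd] := acg e e0.
(* Small for absolute continuity, and so small that replacing K by 0 on the
   intervals inside U costs at most e. *)
pose eta := Num.min d (e / (`|K| + 1)).
have eta0 : 0 < eta.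
  by rewrite lt_min d0 divr_gt0//= ltr_wpDl.
have n1 (x : R) : mu.-negligible [set x].
  by exists [set x]; split => //; rewrite lebesgue_measure_set1.
(* The end points join the exceptional set: nothing is known on the far side
   of them. *)
have [N [mN N0 ZN]] : mu.-negligible (Z `|` [set a; b]).
  by apply: negligibleU => //; exact: negligibleU.
have [U [oU NU]] : exists U, [/\ open U, N `<=` U & (mu U < eta%:E)%E].
  have [|U [oU NU UN]] := @lebesgue_regularity_outer R N eta mN _ eta0.
    by apply: (eq_ind_r (fun z => (z < +oo)%E) _ N0); rewrite ltry.
  exists U; split=> //; apply: le_lt_trans UN.
  have mU := open_measurable oU.
  rewrite -[in leLHS](setDUK NU) measureU//;
    first by rewrite [X in (X + _)%E]N0 add0e.
    exact: measurableD.
  by rewrite setDE setICA setICr setI0.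
move=> muU.
(* The families x, z list the intervals inside U met before y; the measure of
   U before y bounds their total length. *)
pose P y := exists m (x z : nat -> R),
 [/\ forall i, (i < m)%N -> a <= x i /\ x i <= z i /\ z i <= y,
    forall i j, (i < j < m)%N -> z i <= x j,
    ((\sum_(i < m) (z i - x i))%:E <= mu (U `&` `[a, y[))%E &
    g y - g a <= K * (y - a)
      + \sum_(i < m) (`|g (z i) - g (x i)| + `|K| * (z i - x i))].
have : P b.
  apply: (straddle_induction ab) => [|c /andP[ac cb]].
    exists 0%N, (fun=> 0), (fun=> 0); split=> //.
    - by rewrite big_ord0 measure_ge0.
    - by rewrite big_ord0 !subrr mulr0 addr0.
  have [Uc|nUc] := pselect (U c).
    have /nbhs_ballP[r/= r0 rU] : nbhs c U by exact: open_nbhs_nbhs.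
    exists r => // y z ay ry yc cz zr zb [m [x [w [H1 H2 H3 H4]]]].
    have yz : y <= z by exact: le_trans cz.
    have yzU : `[y, z[ `<=` U.
      move=> t /=; rewrite in_itv/= => /andP[yt tz]; apply: rU.
      by rewrite /ball/= ltr_norml; apply/andP; split; lra.
    exists m.+1, (fun i => if (i < m)%N then x i else y),
      (fun i => if (i < m)%N then w i else z).
    have ordm (i : 'I_m) : (i < m)%N by [].
    split.
    - move=> i; rewrite ltnS; case: ltnP => [im _|].
        by have [? [? wy]] := H1 i im; split=> //; split => //;
          exact: le_trans yz.
      by [].
    - move=> i j /andP[ij]; rewrite ltnS => jm.
      rewrite (leq_trans ij jm); case: ltnP => [jm'|_].
        by apply: H2; rewrite ij.
      by have [? []] := H1 i (leq_trans ij jm).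
    - rewrite big_ord_recr/= ltnn; under eq_bigr do rewrite ordm.
      have -> : U `&` `[a, z[ = (U `&` `[a, y[) `|` `[y, z[.
        apply/seteqP; split=> t/=; rewrite !in_itv/=.
          move=> [Ut /andP[at_ tz]]; rewrite at_ tz andbT/=.
          by case: ltP => ty; [left|right].
        move=> [[Ut /andP[at_ ty]]|/andP[yt tz]].
          by rewrite at_ (lt_le_trans ty).
        split; first by apply: yzU; rewrite /= in_itv/= yt.
        by rewrite tz (le_trans ay).
      have mU : measurable (U `&` `[a, y[) by apply: measurableI => //;
        exact: open_measurable.
      rewrite measureU//; last first.
        rewrite -subset0 => t [[_]]/=;
          rewrite !in_itv/= => /andP[_ ty] /andP[yt _].
        by move: (lt_le_trans ty yt); rewrite ltxx.
      rewrite EFinD; apply: leeD; first exact: H3.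
      suff : ((z - y)%:E <= mu `[y, z[%classic)%E by [].
      rewrite lebesgue_measure_itv/= lte_fin -EFinB.
      by case: ltP => // zy; rewrite lee_fin subr_le0.
    - rewrite big_ord_recr/= ltnn; under eq_bigr do rewrite ordm.
      have := ler_norm (g z - g y).
      have : - (K * (z - y)) <= `|K| * (z - y).
        by rewrite -mulNr ler_wpM2r ?subr_ge0// -normrN ler_norm.
      set S := \sum_(_ < _) _ in H4 *; lra.
  have nac : a < c < b.
    have nN : ~ [set a; b] c by move=> abc; apply/nUc/NU/ZN; right.
    by rewrite !lt_neqAle ac cb !andbT; apply/andP; split; apply/eqP => ca;
      apply: nN; [left|right].
  have [|d' dgc dC] := dg c nac; first by move=> Zc; apply/nUc/NU/ZN; left.
  have [r r0 Hr] := is_derive_straddle dgc e0.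
  exists r => // y z ay ry yc cz zr zb [m [x [w [H1 H2 H3 H4]]]].
  have yz : y <= z by exact: le_trans cz.
  exists m, x, w; split=> //.
  - by move=> i im; have [? [? wy]] := H1 i im; split=> //; split => //;
    exact: le_trans yz.
  - apply: (le_trans H3); apply: le_measure; rewrite ?inE.
    + by apply: measurableI => //; exact: open_measurable.
    + by apply: measurableI => //; exact: open_measurable.
    + apply: setIS => t/=; rewrite !in_itv/= => /andP[-> ty];
      exact: lt_le_trans yz.
  - have := Hr y z ry yc cz zr.
    have : (d' + e) * (z - y) <= K * (z - y) by rewrite ler_wpM2r ?subr_ge0//
      /K lerD2r.
    set S := \sum_(_ < _) _ in H4 *; lra.
move=> [m [x [z [H1 H2 H3 H4]]]].
have lsum : \sum_(i < m) (z i - x i) < eta.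
  rewrite -lte_fin; apply: (le_lt_trans H3); apply: le_lt_trans muU.
  apply: le_measure; rewrite ?inE; last by apply: subIsetl.
    by apply: measurableI => //; exact: open_measurable.
  exact: open_measurable.
have s0 : 0 <= \sum_(i < m) (z i - x i).
  by apply: sumr_ge0 => i _; rewrite subr_ge0; have [? []] := H1 i (ltn_ord i).
have gsum : \sum_(i < m) `|g (z i) - g (x i)| < e.
  apply: (Hd m (x \o val) (z \o val)) => [i|i j ij|]/=.
  - by have := H1 i (ltn_ord i).
  - have : (i < j)%N || (j < i)%N by rewrite -neq_ltn.
    by case/orP => ?; [left|right]; apply: H2; apply/andP.
  - by apply: (lt_le_trans lsum); rewrite ge_min lexx.
have Ksum : `|K| * \sum_(i < m) (z i - x i) <= e.
  have le1 : \sum_(i < m) (z i - x i) <= e / (`|K| + 1).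
    by apply: (le_trans (ltW lsum)); rewrite ge_min lexx orbT.
  have K1 : 0 < `|K| + 1 by rewrite ltr_wpDl.
  apply: (@le_trans _ _ ((`|K| + 1) * \sum_(i < m) (z i - x i))).
    by rewrite ler_wpM2r// lerDl.
  by rewrite mulrC -ler_pdivlMr.
move: H4; rewrite big_split/= -mulr_sumr.
set S := \sum_(_ < _) _ in Ksum *; set S' := \sum_(_ < _) _ in gsum *.
by rewrite /K; lra.
Qed.

Section RealAC.
Context (R : realType).

Lemma real_abs_continuous_restrict (a b c d : R) (g : R -> R) :
  a <= c -> d <= b -> real_abs_continuous a b g -> real_abs_continuous c d g.
Proof.
move=> ac db H e e0; have [r r0 Hr] := H e e0; exists r => // m x y H1 H2 H3.
apply: Hr => // i; have [h1 [h2 h3]] := H1 i.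
by split; [lra|split => //; lra].
Qed.

Lemma lipschitz_real_abs_continuous (a b K : R) (g : R -> R) :
  (forall s t, a <= s -> s <= t -> t <= b -> `|g t - g s| <= K * (t - s)) ->
  real_abs_continuous a b g.
Proof.
move=> H e e0; exists (e / (`|K| + 1)); first by rewrite divr_gt0// ltr_wpDl.
move=> m x y H1 _; rewrite ltr_pdivlMr ?ltr_wpDl// => lt.
apply: le_lt_trans lt; rewrite mulr_suml; apply: ler_sum => i _.
have [ax [xy yb]] := H1 i.
apply: (le_trans (H _ _ ax xy yb)); rewrite mulrC ler_wpM2l ?subr_ge0//.
by apply: (le_trans (ler_norm _)); rewrite lerDl.
Qed.

End RealAC.

(** * The Euclidean pairing on row vectors *)

Section Dot.
Context (R : realType) (n : nat).
Implicit Types x y z : 'rV[R]_n.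

Lemma dotvC x y : dotv x y = dotv y x.
Proof. by apply: eq_bigr => i _; rewrite mulrC. Qed.

Lemma dotvDr x y z : dotv x (y + z) = dotv x y + dotv x z.
Proof. by rewrite -big_split; apply: eq_bigr => i _; rewrite mxE mulrDr. Qed.

Lemma dotvZr a x y : dotv x (a *: y) = a * dotv x y.
Proof. by rewrite /dotv mulr_sumr; apply: eq_bigr => i _;
  rewrite mxE mulrCA. Qed.

Lemma dotv0 x : dotv x 0 = 0.
Proof. by rewrite -(scale0r (0 : 'rV[R]_n)) dotvZr mul0r. Qed.

Lemma dotvNr x y : dotv x (- y) = - dotv x y.
Proof. by rewrite -scaleN1r dotvZr mulN1r. Qed.

Lemma dotvBr x y z : dotv x (y - z) = dotv x y - dotv x z.
Proof. by rewrite dotvDr dotvNr. Qed.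

Lemma dotvBl x y z : dotv (x - y) z = dotv x z - dotv y z.
Proof. by rewrite dotvC dotvBr !(dotvC z). Qed.

Lemma dotvDl x y z : dotv (x + y) z = dotv x z + dotv y z.
Proof. by rewrite dotvC dotvDr !(dotvC z). Qed.

Lemma dotvZl a x y : dotv (a *: x) y = a * dotv x y.
Proof. by rewrite dotvC dotvZr dotvC. Qed.

Lemma dotv_ge0 x : 0 <= dotv x x.
Proof. by apply: sumr_ge0 => i _; rewrite -expr2 sqr_ge0. Qed.

Lemma dotv_eq0 x : dotv x x = 0 -> x = 0.
Proof.
move=> /eqP; rewrite psumr_eq0 => [/allP x0|i _];
  last by rewrite -expr2 sqr_ge0.
apply/rowP => i; rewrite mxE; apply/eqP.
by have := x0 i (mem_index_enum _); rewrite mulf_eq0 orbb.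
Qed.

Lemma coord_le_norm x (i : 'I_n) : `|x ord0 i| <= `|x|.
Proof.
rewrite [leRHS]mx_normrE.
by apply: (le_trans _ (le_bigmax _ _ (ord0, i))).
Qed.

Lemma norm_le_coord x c : 0 <= c -> (forall i, `|x ord0 i| <= c) -> `|x| <= c.
Proof.
move=> c0 H; rewrite [leLHS]mx_normrE; apply: bigmax_le => // -[i j] _ /=.
rewrite (ord1 i). exact: H.
Qed.

Lemma normr_dotv x y : `|dotv x y| <= n%:R * (`|x| * `|y|).
Proof.
apply: (le_trans (ler_norm_sum _ _ _)).
apply: (@le_trans _ _ (\sum_(i < n) `|x| * `|y|)).
  by apply: ler_sum => i _; rewrite normrM ler_pM// coord_le_norm.
by rewrite sumr_const card_ord mulr_natl.
Qed.

(** Together with [normr_dotv] this compares the Euclidean norm with the max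
    norm. *)
Lemma sqr_norm_le_dotv x : `|x| ^+ 2 <= dotv x x.
Proof.
have [->|x0] := eqVneq x 0; first by rewrite normr0 expr0n/= dotv_ge0.
have [|[i j] /= xij] := @mx_norm_neq0 _ _ _ x.
  by apply: contra_neq x0 => /mx_norm_eq0.
rewrite [`|x|]xij (ord1 i) real_normK ?num_real// /dotv (bigD1 j)//= expr2
  lerDl.
by apply: sumr_ge0 => k _; rewrite -expr2 sqr_ge0.
Qed.

Lemma continuous_coord (i : 'I_n) : continuous (fun x : 'rV[R]_n => x ord0 i).
Proof. by move=> x; exact: coord_continuous. Qed.

Lemma continuous_dotv (T : topologicalType) (g h : T -> 'rV[R]_n) :
  continuous g -> continuous h -> continuous (fun t => dotv (g t) (h t)).
Proof.
move=> cg ch; rewrite /dotv; elim: (index_enum _) => [|i r IH] t.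
  by under eq_fun do rewrite big_nil; exact: cvg_cst.
rewrite /continuous_at; under eq_fun do rewrite big_cons; rewrite big_cons.
apply: cvgD; last exact: IH.
apply: cvgM.
  by apply: (@continuous_comp _ _ _ g (fun x : 'rV[R]_n => x ord0 i));
    [exact: cg|exact: continuous_coord].
by apply: (@continuous_comp _ _ _ h (fun x : 'rV[R]_n => x ord0 i));
  [exact: ch|exact: continuous_coord].
Qed.

End Dot.

Section CurveCoordinates.
Context (R : realType) (n : nat).

Lemma is_derive_coord (v : R -> 'rV[R]_n) (t : R) (d : 'rV[R]_n) i :
  is_derive t 1 v d -> is_derive t 1 (fun s => v s ord0 i) (d ord0 i).
Proof.
move=> [du <-]; apply: DeriveDef.
  by have [H _] := derivable_mxP v t 1; exact: H.
by rewrite derive_mx// mxE.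
Qed.

Lemma is_derive_dotv (t : R) (v w : R -> 'rV[R]_n) (dv dw : 'rV[R]_n) :
  is_derive t 1 v dv -> is_derive t 1 w dw ->
  is_derive t 1 (fun s => dotv (v s) (w s)) (dotv dv (w t) + dotv (v t) dw).
Proof.
move=> hv hw.
have -> : (fun s => dotv (v s) (w s)) =
    \sum_(i < n) ((fun s => v s ord0 i) * (fun s => w s ord0 i)).
  by apply/funext => s; rewrite fct_sumE.
have -> : dotv dv (w t) + dotv (v t) dw =
    \sum_(i < n) (v t ord0 i *: dw ord0 i + w t ord0 i *: dv ord0 i).
  rewrite /dotv -big_split; apply: eq_bigr => i _ /=.
  by rewrite addrC; congr (_ + _); rewrite mulrC.
apply: is_derive_sum => i; by apply: is_deriveM; exact: is_derive_coord.
Qed.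

Lemma abs_continuous_coord (v : R ->
  'rV[R]_n) (a b : R) i : abs_continuous_on a b v ->
  real_abs_continuous a b (fun t => v t ord0 i).
Proof.
move=> acu e e0; have [d d0 H] := acu e e0; exists d => // m x y H1 H2 H3.
apply: le_lt_trans (H m x y H1 H2 H3); apply: ler_sum => k _.
by have := coord_le_norm (v (y k) - v (x k)) i; rewrite !mxE.
Qed.

End CurveCoordinates.

(** * Seminorms and their subgradients *)

Lemma seminorm_subadd (R : realType) (n : nat) (J : 'rV[R]_n -> R) :
  @convex_function R 'rV[R]_n setT J -> abs_one_homogeneous J ->
  forall x y, J (x + y) <= J x + J y.
Proof.
move=> Jc Jh x y.
have h0 : (0 : R) <= 2^-1 by lra.
have h1 : (2^-1 : R) <= 1 by lra.
have /(_ _ _) := Jc (Itv01 h0 h1) x y.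
rewrite !inE => /(_ I I).
rewrite convRE/= /conv/= /unstable.onem.
have -> : (1 - 2^-1 : R) = 2^-1 by lra.
by rewrite -scalerDr Jh ger0_norm// -mulrDr ler_pM2l// invr_gt0.
Qed.

Section Seminorm.
Context (R : realType) (n : nat) (J : 'rV[R]_n -> R).
Hypothesis J0 : forall x, 0 <= J x.
Hypothesis JD : forall x y, J (x + y) <= J x + J y.
Hypothesis Jh : abs_one_homogeneous J.

Lemma seminormN x : J (- x) = J x.
Proof. by rewrite -scaleN1r Jh normrN1 mul1r. Qed.

Lemma seminorm0 : J 0 = 0.
Proof. by rewrite -(scale0r (0 : 'rV[R]_n)) Jh normr0 mul0r. Qed.

(** The sum of the values of [J] on the canonical basis: it bounds [J] on the
    unit ball of the max norm and the coordinates of all subgradients. *)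
Definition seminorm_bound : R := \sum_(i < n) J (delta_mx ord0 i).

Lemma seminorm_bound_ge0 : 0 <= seminorm_bound.
Proof. exact: sumr_ge0. Qed.

Lemma seminorm_le x : J x <= seminorm_bound * `|x|.
Proof.
rewrite [in leLHS](row_sum_delta x) mulr_suml.
apply: (@le_trans _ _ (\sum_(i < n) J (x ord0 i *: delta_mx ord0 i))).
  apply: (big_ind2 (fun a b => J a <= b)) => //; first by rewrite seminorm0.
  by move=> a b c d ab cd; apply: (le_trans (JD _ _)); apply: lerD.
by apply: ler_sum => i _; rewrite Jh mulrC ler_wpM2l// coord_le_norm.
Qed.

Lemma seminorm_continuous : continuous J.
Proof.
move=> x; apply/(@cvgrPdist_lt _ _ _ (nbhs x) (nbhs_filter x)) => e e0.
have k0 : 0 < seminorm_bound + 1 by rewrite ltr_wpDl// seminorm_bound_ge0.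
apply/nbhs_ballP; exists (e / (seminorm_bound + 1)) => /=.
  by rewrite divr_gt0.
move=> y; rewrite -ball_normE /= ltr_pdivlMr// => xy; apply: le_lt_trans xy.
have dist a b : J a - J b <= seminorm_bound * `|a - b|.
  apply: le_trans (seminorm_le _); rewrite lerBlDr.
  by rewrite -[in leLHS](subrK b a).
apply: (@le_trans _ _ (seminorm_bound * `|x - y|)); last first.
  by rewrite mulrC ler_wpM2l// lerDl.
rewrite ler_norml dist andbT lerNl opprB.
by apply: (le_trans (dist _ _)); rewrite distrC.
Qed.

Context (x p : 'rV[R]_n).
Hypothesis px : subdifferential J x p.

(** Test the subgradient inequality at [x + y] and use subadditivity. *)
Lemma subgradient_le y : dotv p y <= J y.
Proof.
have := px (x + y); rewrite addrAC subrr add0r => pxy.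
by rewrite -(lerD2l (J x)) (le_trans pxy).
Qed.

(** Euler's identity: testing at 0 gives the inequality opposite to
    [subgradient_le]. *)
Lemma subgradient_self : dotv p x = J x.
Proof.
apply/eqP; rewrite eq_le subgradient_le/=.
by have := px 0; rewrite seminorm0 sub0r dotvNr subr_le0.
Qed.

Lemma subgradient_ker y : J y = 0 -> dotv p y = 0.
Proof.
move=> Jy; apply/eqP; rewrite eq_le -{1}Jy subgradient_le/=.
by have := subgradient_le (- y); rewrite seminormN Jy dotvNr oppr_le0.
Qed.

Lemma subgradient_coord i : `|p ord0 i| <= seminorm_bound.
Proof.
have pi (z : R) : dotv p (z *: delta_mx ord0 i) = z * p ord0 i.
  rewrite dotvZr /dotv (bigD1 i)//= big1 => [|j ji].
    by rewrite !mxE !eqxx mulr1 addr0.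
  by rewrite !mxE (negbTE ji) andbF mulr0.
have Ji : J (delta_mx ord0 i) <= seminorm_bound.
  by rewrite /seminorm_bound (bigD1 i)//= lerDl; exact: sumr_ge0.
have := subgradient_le (1 *: delta_mx ord0 i).
have := subgradient_le (-1 *: delta_mx ord0 i).
rewrite !pi !Jh normrN1 normr1 !mul1r mulN1r ler_norml.
by move=> *; apply/andP; split; lra.
Qed.

End Seminorm.

Section Coercivity.
Context (R : realType) (n : nat) (J : 'rV[R]_n -> R).
Hypothesis J0 : forall x, 0 <= J x.
Hypothesis JD : forall x y, J (x + y) <= J x + J y.
Hypothesis Jh : abs_one_homogeneous J.

Let cJ : continuous J := seminorm_continuous J0 JD Jh.

(** The closest point of the kernel to [f] exists because the points of the
    kernel that are not farther from [f] than 0 form a compact set; that the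
    remainder is orthogonal to the kernel is the first-order condition. *)
Lemma seminorm_closest_ker f :
  exists2 a, J a = 0 & forall z, J z = 0 -> dotv (f - a) z = 0.
Proof.
pose D (z : 'rV[R]_n) := dotv (f - z) (f - z).
have cD : continuous D.
  have c1 : continuous (fun z : 'rV[R]_n => f - z).
    by move=> z; apply: (@continuousB R 'rV[R]_n 'rV[R]_n (cst f) id z);
      [exact: cst_continuous | by move=> A; exact].
  exact: continuous_dotv.
pose K := J @^-1` [set 0] `&` D @^-1` [set r | r <= D 0].
have K0 : K 0 by split => //=; exact: seminorm0.
have Kcpt : compact K.
  apply: bounded_closed_compact; last first.
    apply: closedI; first by apply: closed_comp => // ? _; exact: cJ.
    by apply: closed_comp; [move=> ? _; exact: cD|exact: closed_le].
  exists (`|f| + (D 0 + 1)); split; first exact: num_real.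
  move=> M BM z [_ /= Dz]; apply: le_trans (ltW BM).
  have fz : `|f - z| <= D 0 + 1.
    have D00 : 0 <= D 0 := dotv_ge0 _.
    have := le_trans (sqr_norm_le_dotv (f - z)) Dz.
    by move=> sq; rewrite leNgt; apply/negP => h1; nra.
  have -> : z = f - (f - z) by rewrite opprB addrC subrK.
  by apply: (le_trans (ler_normB _ _)); rewrite lerD2l.
have [|||a aK amin] := @EVT_min_rV R n D K.
- by exists 0.
- exact: Kcpt.
- exact: continuous_subspaceT.
have [Ja Da] := set_mem aK.
exists a => // z Jz; set w := f - a.
(* Minimality on K extends to the whole kernel: outside K the distance is
   larger than at 0. *)
have min s : dotv w w <= dotv (w - s *: z) (w - s *: z).
  have [Dle|/ltW Dgt] := leP (D (a + s *: z)) (D 0).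
    have -> : w - s *: z = f - (a + s *: z) by rewrite /w opprD addrA.
    apply: amin; rewrite inE; split => //=.
    apply/eqP; rewrite eq_le J0 andbT (le_trans (JD _ _))//.
    by rewrite Ja add0r Jh Jz mulr0.
  apply: (le_trans Da); apply: (le_trans Dgt).
  by rewrite /D opprD addrA.
clearbody w.
(* The optimal step along z is s = (w . z) / (z . z). *)
have [z0|z0] := eqVneq (dotv z z) 0.
  by rewrite (dotv_eq0 z0) dotv0.
have zp : 0 < dotv z z by rewrite lt_neqAle eq_sym z0 dotv_ge0.
have := min (dotv w z / dotv z z).
rewrite dotvBr !dotvBl !dotvZr !dotvZl (dotvC z w).
set q := dotv z z in z0 zp *; set d := dotv w z.
have dE : d = d / q * q by rewrite divfK.
move: dE; set s := d / q => dE; rewrite dE => le0.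
have s2 : s ^+ 2 * q <= 0 by rewrite expr2; lra.
have /eqP : s ^+ 2 = 0.
  by apply/eqP; rewrite eq_le sqr_ge0 andbT -(pmulr_lle0 _ zp).
by rewrite sqrf_eq0 => /eqP ->; rewrite mul0r.
Qed.

(** The constant is the minimum of [J] on the unit vectors orthogonal to its
    kernel; it is positive because a vector of the kernel orthogonal to the
    kernel is orthogonal to itself. *)
Lemma seminorm_coercive :
  exists2 c, 0 < c & forall w, (forall z, J z = 0 -> dotv w z = 0) ->
    c * `|w| <= J w.
Proof.
pose K := [set w : 'rV[R]_n | `|w| = 1 /\ forall z, J z = 0 -> dotv w z = 0].
have [K0|/set0P/negP/negPn/eqP K0] := pselect (K !=set0); last first.
  exists 1 => // w wN; have [->|w0] := eqVneq w 0.
    by rewrite normr0 mulr0 J0.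
  exfalso; suff : K (`|w|^-1 *: w) by rewrite K0.
  split; first by rewrite normrZ ger0_norm ?invr_ge0// mulVf// normr_eq0.
  by move=> z Jz; rewrite dotvZl wN// mulr0.
have Kcpt : compact K.
  apply: bounded_closed_compact.
    by exists 1; split; [exact: num_real|move=> M /ltW M1 z [/= -> _]].
  have -> : K = (fun w : 'rV[R]_n => `|w|) @^-1` [set 1] `&`
     \bigcap_(z in [set z | J z = 0]) ((fun w => dotv w z) @^-1` [set 0]).
    by apply/seteqP; split.
  apply: closedI.
    by apply: closed_comp => // ? _; exact: norm_continuous.
  apply: closed_bigI => z _; apply: closed_comp => // w _.
  apply: (@continuous_dotv R n 'rV[R]_n id (cst z)); first by move=> ?;
    exact: cvg_id.
  exact: cst_continuous.
have [|c cK cmin] := @EVT_min_rV R n J K K0 Kcpt.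
  exact: continuous_subspaceT.
have [nc cN] := set_mem cK.
exists (J c).
  rewrite lt_neqAle J0 andbT eq_sym; apply/eqP => Jc.
  have := dotv_eq0 (cN c Jc) => c0; move: nc; rewrite c0 normr0 => /eqP.
  by rewrite eq_sym oner_eq0.
move=> w wN; have [->|w0] := eqVneq w 0; first by rewrite normr0 mulr0 J0.
have nw : 0 < `|w| by rewrite normr_gt0.
have : J c <= J (`|w|^-1 *: w).
  apply: cmin; rewrite inE; split.
    by rewrite normrZ ger0_norm ?invr_ge0// mulVf// normr_eq0.
  by move=> z Jz; rewrite dotvZl wN// mulr0.
by rewrite Jh ger0_norm ?invr_ge0// mulrC ler_pdivlMr.
Qed.

End Coercivity.

(** * Lipschitz continuity and finite extinction of the flow *)

Section Flow.
Context (R : realType) (n : nat) (J : 'rV[R]_n -> R).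
Hypothesis J0 : forall x, 0 <= J x.
Hypothesis JD : forall x y, J (x + y) <= J x + J y.
Hypothesis Jh : abs_one_homogeneous J.
Context (f : 'rV[R]_n) (u : R -> 'rV[R]_n).
Hypothesis uGF : gradient_flow J f u.

Lemma flow_derive : exists p N, mu.-negligible N /\
  forall r, 0 < r -> ~ N r ->
    is_derive r 1 u (- p r) /\ subdifferential J (u r) (p r).
Proof.
have [_ _ [p [N [mN N0 HN]]]] := uGF.
exists p, N; split; first by exists N; split.
move=> r r0 Nr; apply: contrapT => nr; apply: Nr; apply: HN => /= H.
by apply: nr; exact: H.
Qed.

Lemma flow_lipschitz s t : 0 <= s -> s <= t ->
  `|u t - u s| <= seminorm_bound J * (t - s).
Proof.
move=> s0 st; have C0 := seminorm_bound_ge0 J0.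
have [acu _ _] := uGF; have [p [N [negN du]]] := flow_derive.
apply: norm_le_coord => [|i]; first by rewrite mulr_ge0// subr_ge0.
have acs : real_abs_continuous s t (fun t => u t ord0 i).
  apply: (@real_abs_continuous_restrict _ 0 (t + 1)) => //; first by lra.
  by apply: abs_continuous_coord; apply: acu; lra.
rewrite !mxE ler_norml; apply/andP; split.
  have acN : real_abs_continuous s t (fun t => - u t ord0 i).
    move=> e e0; have [d d0 H] := acs e e0; exists d => // m x y H1 H2 H3.
    apply: le_lt_trans (H m x y H1 H2 H3); apply: ler_sum => k _.
    by rewrite -opprB normrN opprK addrC.
  have := ae_derivative_le st acN negN.
  have H r : s < r < t -> ~ N r ->
      exists2 d : R, is_derive r 1 (fun t => - u t ord0 i) d &
        d <= seminorm_bound J.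
    move=> /andP[sr _] Nr; have [dr pr] := du r (le_lt_trans s0 sr) Nr.
    exists (- (- p r) ord0 i); first exact: is_deriveN (is_derive_coord i dr).
    rewrite mxE opprK (le_trans (ler_norm _))//.
    exact: (subgradient_coord J0 JD Jh pr).
  move=> /(_ _ H); lra.
apply: (ae_derivative_le st acs negN) => r /andP[sr _] Nr.
have [dr pr] := du r (le_lt_trans s0 sr) Nr; exists ((- p r) ord0 i).
  exact: is_derive_coord.
by rewrite mxE (le_trans (ler_norm _))// normrN (subgradient_coord J0 JD Jh pr).
Qed.

Lemma flow_dist s t : 0 <= s -> 0 <= t ->
  `|u t - u s| <= seminorm_bound J * `|t - s|.
Proof.
move=> s0 t0; have [st|/ltW ts] := leP s t.
  by rewrite ger0_norm ?subr_ge0// flow_lipschitz.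
by rewrite distrC [X in _ * X]distrC ger0_norm ?subr_ge0// flow_lipschitz.
Qed.

Lemma flow_lipschitz_on : [lipschitz u t | t in `[0, +oo[].
Proof.
exists (seminorm_bound J); split; first exact: num_real.
move=> M /ltW BM [t s] /= [/=]; rewrite !in_itv/= !andbT => t0 s0.
by apply: (le_trans (flow_dist _ _)) => //; rewrite ler_wpM2r.
Qed.

(** Subgradients are orthogonal to the kernel of [J], so the component of the
    flow along the kernel never changes. *)
Lemma flow_perp_ker z t : J z = 0 -> 0 <= t -> dotv (u t - f) z = 0.
Proof.
move=> Jz t0; have [p [N [negN du]]] := flow_derive.
have [_ u0 _] := uGF.
have ac y : real_abs_continuous 0 t (fun s => dotv (u s) y).
  apply: (@lipschitz_real_abs_continuous _ _ _ (n%:R * seminorm_bound J *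
    `|y|)) => r s r0 rs st.
  rewrite -dotvBl (le_trans (normr_dotv _ _))// -!mulrA ler_wpM2l//.
  rewrite (mulrC `|y|) mulrA ler_wpM2r//.
  by apply: flow_lipschitz.
have le0 y : J y = 0 -> dotv (u t) y - dotv (u 0) y <= 0.
  move=> Jy; have := ae_derivative_le t0 (ac y) negN.
  move=> /(_ 0); rewrite mul0r; apply => r /andP[r0 _] Nr.
  have [dr sr] := du r r0 Nr.
  exists (dotv (- p r) y + dotv (u r) 0).
    exact: (is_derive_dotv dr (is_derive_cst y r 1)).
  rewrite dotv0 addr0 dotvC dotvNr dotvC.
  by rewrite (subgradient_ker JD Jh sr Jy) oppr0.
have := le0 z Jz; have := le0 (- z); rewrite seminormN// => /(_ Jz).
by rewrite !dotvNr u0 dotvBl; lra.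
Qed.

(** With [E] the squared Euclidean norm of [w = u - a], the derivative of [E]
    is [- 2 J w], and [J w >= c' sqrt E]; hence [sqrt E] decreases at rate at
    least [c'] as long as it is positive, which bounds the time for which it
    can be. *)
Lemma flow_extinction : exists2 T, 0 < T &
  exists a, forall t, T <= t -> u t = a.
Proof.
have [p [N [negN du]]] := flow_derive; have [_ u0 _] := uGF.
have [a Ja fa] := seminorm_closest_ker J0 JD Jh f.
have [c c0 Jc] := seminorm_coercive J0 JD Jh.
pose w t := u t - a; pose E t := dotv (w t) (w t).
have wN t z : 0 <= t -> J z = 0 -> dotv (w t) z = 0.
  move=> t0 Jz; have -> : w t = (u t - f) + (f - a) by rewrite addrA subrK.
  by rewrite dotvDl fa// flow_perp_ker// addr0.
have Jw t : J (u t) = J (w t).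
  apply/eqP; rewrite eq_le; apply/andP; split.
    by rewrite -[in leLHS](subrK a (u t)) (le_trans (JD _ _))// Ja addr0.
  by rewrite (le_trans (JD _ _))// seminormN// Ja addr0.
have dE r : 0 < r -> ~ N r -> is_derive r 1 E (- 2 * J (w r)).
  move=> r0 Nr; have [dr sr] := du r r0 Nr.
  have dw : is_derive r 1 w (- p r).
    rewrite -[- p r]subr0; apply: is_deriveB.
  apply: (is_derive_eq (is_derive_dotv dw dw)).
  rewrite (dotvC _ (w r)) dotvNr (dotvC (w r)) dotvBr.
  rewrite (subgradient_self JD Jh sr) (subgradient_ker JD Jh sr Ja) Jw.
  by ring.
pose B := seminorm_bound J.
have B0 : 0 <= B by exact: seminorm_bound_ge0.
have Elip T s t : 0 <= s -> s <= t -> t <= T ->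
    `|E t - E s| <= n%:R * (B * (2 * (`|w 0| + B * T))) * (t - s).
  move=> s0 st tT.
  have -> : E t - E s = dotv (w t - w s) (w t + w s).
    by rewrite (dotvBl (w t)) !(dotvDr _ (w t)) (dotvC (w s) (w t)) /E; ring.
  apply: (le_trans (normr_dotv _ _)); rewrite -[leRHS]mulrA ler_wpM2l//.
  rewrite -[leRHS]mulrA [_ * (t - s)]mulrC mulrA; apply: ler_pM => //.
    by rewrite /w opprB addrA subrK flow_lipschitz.
  have wb r : 0 <= r -> r <= T -> `|w r| <= `|w 0| + B * T.
    move=> r0 rT; have -> : w r = w 0 + (u r - u 0).
      by rewrite /w [RHS]addrC addrA subrK.
    apply: (le_trans (ler_normD _ _)); rewrite lerD2l.
    by apply: (le_trans (flow_lipschitz _ r0)); rewrite ?subr0 ?ler_wpM2l.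
  apply: (le_trans (ler_normD _ _)).
  have := wb s s0 (le_trans st tT); have := wb t (le_trans s0 st) tT; lra.
have Edec s t : 0 <= s -> s <= t -> E t <= E s.
  move=> s0 st; rewrite -subr_le0.
  have acE : real_abs_continuous s t E.
    apply: (@lipschitz_real_abs_continuous _ _ _ (n%:R * (B * (2 * (`|w 0| + B
      * t))))) => r q sr rq qt.
    by apply: Elip => //; exact: le_trans sr.
  have := ae_derivative_le st acE negN => /(_ 0); rewrite mul0r; apply.
  move=> r /andP[sr _] Nr; exists (- 2 * J (w r)).
    by apply: dE => //; exact: le_lt_trans sr.
  by have := J0 (w r); lra.
pose c' := c / n.+1%:R.
have c'0 : 0 < c' by rewrite divr_gt0.
(* The rate c' exhausts sqrt (E 0) strictly before this time. *)
exists (Num.sqrt (E 0) / c' + 1).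
  by rewrite ltr_wpDl// divr_ge0// ?sqrtr_ge0// ltW.
exists a => T HT; apply/eqP; rewrite -subr_eq0; apply/eqP.
have T0 : 0 <= T.
  by apply: le_trans HT; rewrite addr_ge0// divr_ge0// ?sqrtr_ge0// ltW.
apply: dotv_eq0; apply: contrapT => ET; pose m := Num.sqrt (E T).
have ET0 : 0 < E T by rewrite lt_neqAle dotv_ge0 andbT eq_sym; exact/eqP.
have Epos r : r <= T -> 0 <= r -> 0 < E r.
  by move=> rT r0; apply: lt_le_trans (Edec _ _ r0 rT).
have m0 : 0 < m by rewrite sqrtr_gt0.
(* The square root is Lipschitz here because E stays above E T. *)
have ach : real_abs_continuous 0 T (fun t => Num.sqrt (E t)).
  apply: (@lipschitz_real_abs_continuous _ _ _ (n%:R * (B * (2 * (`|w 0| + B *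
    T))) / m)) => r s r0 rs sT.
  rewrite mulrAC ler_pdivlMr//; apply: (le_trans _ (Elip T r s r0 rs sT)).
  have rT := le_trans rs sT; have s0 := le_trans r0 rs.
  have -> : E s - E r =
      (Num.sqrt (E s) - Num.sqrt (E r)) * (Num.sqrt (E s) + Num.sqrt (E r)).
    by rewrite -subr_sqr !sqr_sqrtr ?dotv_ge0.
  rewrite normrM ler_wpM2l// ger0_norm ?addr_ge0 ?sqrtr_ge0//.
  apply: (@le_trans _ _ (Num.sqrt (E s))); last by rewrite lerDl sqrtr_ge0.
  by rewrite ler_sqrt ?dotv_ge0// Edec.
have := ae_derivative_le (C := - c') T0 ach negN.
have H : forall t, 0 < t < T -> ~ N t ->
    exists2 d : R, is_derive t 1 (fun t => Num.sqrt (E t)) d & d <= - c'.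
  move=> t /andP[t0 tT] Nt.
  have Et := Epos t (ltW tT) (ltW t0).
  exists ((2 * Num.sqrt (E t))^-1 * (- 2 * J (w t))).
    apply: (@is_derive1_comp _ Num.sqrt E); last exact: dE.
    exact: is_derive1_sqrt.
  have h0 : 0 < Num.sqrt (E t) by rewrite sqrtr_gt0.
  have hle : Num.sqrt (E t) <= n.+1%:R * `|w t|.
    rewrite -(ler_pXn2r (ltn0Sn 1)) ?nnegrE ?sqrtr_ge0 ?mulr_ge0//.
    rewrite sqr_sqrtr ?dotv_ge0//; apply: (le_trans (ler_norm _)).
    apply: (le_trans (normr_dotv _ _));
      rewrite exprMn -expr2 ler_wpM2r ?sqr_ge0//.
    by rewrite -natrX ler_nat; apply: (@leq_trans n.+1) => //;
      rewrite leq_pmulr.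
  have cJ : c' * Num.sqrt (E t) <= J (w t).
    apply: le_trans (Jc (w t) (fun z => wN t z (ltW t0))).
    by rewrite /c' -mulrA ler_wpM2l ?(ltW c0)// mulrC ler_pdivrMr// mulrC.
  have -> : (2 * Num.sqrt (E t))^-1 * (- 2 * J (w t)) =
      - (J (w t) / Num.sqrt (E t)).
    by field; rewrite gt_eqF.
  by rewrite lerN2 ler_pdivlMr.
move=> /(_ H); rewrite subr0 => hT.
have : Num.sqrt (E 0) / c' < T by lra.
rewrite ltr_pdivrMr// => ?; have := sqrtr_ge0 (E T); lra.
Qed.

End Flow.

(** * Borel measurability of the derivative *)

Section DerivableSet.
Context (R : realType) (g : R -> R).
Hypothesis cg : continuous g.

Definition diff_quotient (h t : R) : R := h^-1 * (g (h + t) - g t).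

Lemma diff_quotient_continuous h : continuous (diff_quotient h).
Proof.
move=> t; apply: cvgM; first exact: cvg_cst.
apply: cvgB; last exact: cg.
by apply: (@continuous_comp _ _ _ (fun s => h + s) g);
  [apply: cvgD; [exact: cvg_cst|exact: cvg_id]|exact: cg].
Qed.

Lemma derivableE t : derivable g t 1 = cvg (diff_quotient h t @[h --> 0^']).
Proof.
suff -> : diff_quotient^~ t =
  fun h : R => h^-1 *: ((g \o shift t) (h *: 1) - g t) by [].
by apply/funext => h; rewrite /diff_quotient /= [h *: 1]mulr1.
Qed.

Let near_equal k m := \bigcap_(hh in [set hh : R * R |
    [/\ hh.1 != 0, hh.2 != 0, `|hh.1| < m.+1%:R^-1 & `|hh.2| < m.+1%:R^-1]])
  [set t : R | `|diff_quotient hh.1 t - diff_quotient hh.2 t| <= k.+1%:R^-1].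

(** Cauchy's criterion for the difference quotients.  It compares all pairs of
    small increments, which costs nothing: any intersection of closed sets is
    closed. *)
Lemma derivable_setE :
  [set t | derivable g t 1] = \bigcap_k \bigcup_m near_equal k m.
Proof.
apply/seteqP; split => t /=; rewrite derivableE.
  move=> /cvg_ex[l /cvgrPdist_lt cl] k _.
  have k0 : (0 : R) < k.+1%:R^-1 / 2 by rewrite divr_gt0// invr_gt0.
  have /nbhs_ballP[r/= r0 Hr] := cl _ k0.
  have [m _ mr] := near_infty_natSinv_lt (PosNum r0).
  exists m => // -[h h'] /= [h0 h'0 hm h'm].
  have H (x : R) : x != 0 -> `|x| < m.+1%:R^-1 ->
    `|l - diff_quotient x t| < k.+1%:R^-1 / 2.
    move=> x0 xm; apply: Hr => //; rewrite /ball/= sub0r normrN.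
    by apply: (lt_trans xm); apply: mr => /=.
  have := H h h0 hm; have := H h' h'0 h'm.
  have -> : diff_quotient h t - diff_quotient h' t =
      (l - diff_quotient h' t) - (l - diff_quotient h t) by ring.
  move=> H1 H2; apply: (le_trans (ler_normB _ _)).
  by rewrite [leRHS]splitr; apply: lerD; exact: ltW.
move=> Ht; apply/cauchy_cvgP/cauchy_exP => e e0.
have [k _ ke] := near_infty_natSinv_lt (PosNum e0).
have [m _ Hm] := Ht k I.
have m0 : (0 : R) < m.+1%:R^-1 by rewrite invr_gt0.
pose h0 : R := m.+1%:R^-1 / 2.
exists (diff_quotient h0 t).
suff : \forall h \near (0 : R)^',
  ball (diff_quotient h0 t) e (diff_quotient h t) by [].
near=> h.
rewrite /ball/=; apply: (le_lt_trans _ (ke k (leqnn k))).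
apply: (Hm (h0, h)); split => /=.
- by rewrite gt_eqF// divr_gt0.
- by near: h; exact: nbhs_dnbhs_neq.
- by rewrite gtr0_norm /h0 ?divr_gt0// ltr_pdivrMr// ltr_pMr// ltr1n.
- by near: h; exact: dnbhs0_lt.
Unshelve. all: by end_near. Qed.

Lemma measurable_derivable : measurable [set t | derivable g t 1].
Proof.
rewrite derivable_setE; apply: bigcapT_measurable => k.
apply: bigcupT_measurable => m; apply: closed_measurable.
apply: closed_bigI => -[h h'] _ /=.
apply: (@closed_comp _ _ (fun t => `|diff_quotient h t - diff_quotient h' t|)
  [set x | x <= k.+1%:R^-1]); last exact: closed_le.
move=> t _; apply: cvg_norm; apply: cvgB; exact: diff_quotient_continuous.
Qed.

End DerivableSet.

Lemma cvg_inv_succ_dnbhs (R : realType) : (m.+1%:R : R)^-1 @[m --> \oo] --> 0^'.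
Proof.
move=> A /nbhs_ballP[r/= r0 rA].
have [m _ mr] := near_infty_natSinv_lt (PosNum r0).
exists m => // k mk; apply: rA; last by rewrite /= gt_eqF// invr_gt0.
by rewrite /ball/= sub0r normrN gtr0_norm ?invr_gt0//; exact: mr.
Qed.

Section MeasurableDerivative.
Context (R : realType) (n : nat) (v : R -> 'rV[R]_n).
Hypothesis cv : continuous v.

Let vi (i : 'I_n) (t : R) := v t ord0 i.

Let cvi i : continuous (vi i).
Proof.
move=> t; apply: (@continuous_comp _ _ _ v (fun x : 'rV[R]_n => x ord0 i));
  [exact: cv|exact: coord_continuous].
Qed.

Lemma measurable_derivable_rV : measurable [set t | derivable v t 1].
Proof.
have -> : [set t | derivable v t 1] =
    \bigcap_(i in [set: 'I_n]) [set t | derivable (vi i) t 1].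
  apply/seteqP; split => t /=.
    by move=> /derivable_mxP H i _; exact: H.
  by move=> H; apply/derivable_mxP => i j; rewrite (ord1 i); exact: H.
apply: fin_bigcap_measurable => // i _; exact: measurable_derivable.
Qed.

(** On the set of differentiability the derivative is a limit of difference
    quotients with steps [1 / (m + 1)]; elsewhere it is the default value
    [point] of a limit that does not exist, which is a constant. *)
Lemma measurable_derive1_coord i :
  measurable_fun setT (fun t => derive1 v t ord0 i).
Proof.
pose p : R := (point : 'rV[R]_n) ord0 i.
pose F m t := if t \in [set t | derivable v t 1] then
  diff_quotient (vi i) m.+1%:R^-1 t else p.
apply: (@measurable_fun_cvg _ _ _ _ F).
  move=> m; apply: measurable_fun_ifT.
  - apply: (measurable_fun_bool true); rewrite setTI.
    rewrite (_ : _ @^-1` _ = [set t | derivable v t 1]);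
      first exact: measurable_derivable_rV.
    by apply/seteqP; split => t; [exact: set_mem|exact: mem_set].
  - by apply: continuous_measurable_fun; exact: diff_quotient_continuous.
  - exact: measurable_cst.
move=> t _; rewrite derive1E.
have [dt|ndt] := pselect (derivable v t 1).
  have -> : F^~ t = fun m => diff_quotient (vi i) m.+1%:R^-1 t.
    by apply/funext => m; rewrite /F mem_set.
  rewrite derive_mx// mxE.
  have /derivable_mxP/(_ ord0 i) := dt; rewrite derivableE => dti.
  have -> : 'D_1 (vi i) t = lim (diff_quotient (vi i) h t @[h --> 0^']).
    rewrite /derive; suff -> : (diff_quotient (vi i))^~ t =
      fun h : R => h^-1 *: ((vi i \o shift t) (h *: 1) - vi i t) by [].
    by apply/funext => h; rewrite /diff_quotient /= [h *: 1]mulr1.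
  exact: (cvg_comp _ _ (@cvg_inv_succ_dnbhs R) dti).
have -> : F^~ t = cst p by apply/funext => m; rewrite /F memNset.
rewrite /derive dvgP//; exact: cvg_cst.
Qed.

End MeasurableDerivative.

(** Only the half-line is under control: extending [u] by [u 0] to the left
    makes it continuous and changes no derivative at a positive point. *)
Lemma measurable_derive1_lipschitz (R : realType) (n : nat)
    (u : R -> 'rV[R]_n) (K : R) i :
  (forall s t, 0 <= s -> 0 <= t -> `|u t - u s| <= K * `|t - s|) ->
  measurable_fun (`[0, +oo[ : set (measurableTypeR R))
    (fun t => derive1 u t ord0 i).
Proof.
move=> ulip; have K0 : 0 <= K.
  by have := ulip 0 1 (lexx _) ler01; rewrite subr0 normr1 mulr1;
    apply: le_trans.
pose v t := u (Num.max t 0).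
have cv : continuous v.
  move=> t; apply/cvgrPdist_lt => e e0; near=> s.
  have ts : `|t - s| < e / (K + 1).
    near: s; apply: cvgr_dist_lt; rewrite ?divr_gt0 ?ltr_wpDl//; exact: cvg_id.
  rewrite ltr_pdivlMr ?ltr_wpDl// in ts.
  apply: (le_lt_trans _ ts); rewrite mulrC.
  apply: (le_trans (ulip _ _ _ _)); rewrite ?le_max ?lexx ?orbT//.
  apply: ler_pM => //; first by rewrite lerDl.
  by rewrite /Num.max; case: (ltP t 0); case: (ltP s 0) => s0 t0;
    rewrite ler_norml; apply/andP; split; have := ler_norm (t - s);
      have := ler_norm (s - t); rewrite (distrC s t); lra.
have -> : (`[0, +oo[%classic : set (measurableTypeR R)) = [set 0] `|` `]0, +oo[.
  apply/seteqP; split => t /=; rewrite !in_itv/= !andbT.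
    by rewrite le_eqVlt => /predU1P[<-|]; [left|right].
  by move=> [->|/ltW].
apply/(measurable_funU _ (measurable_set1 0) (measurable_itv _)).
split; first exact: measurable_fun_set1.
apply: (eq_measurable_fun (fun t => derive1 v t ord0 i)).
  move=> t /set_mem /=; rewrite in_itv/= andbT => t0.
  congr (fun_of_matrix _ ord0 i); rewrite !derive1E; apply: near_eq_derive.
  near=> s; rewrite /v max_l // ltW//; near: s; exact: lt_nbhsr.
apply: measurable_funTS; exact: measurable_derive1_coord.
Unshelve. all: by end_near. Qed.

(** The bound holds at every positive point, so it must account for the
    default value [point] where [u] is not differentiable. *)
Lemma derive1_lipschitz_bound (R : realType) (n : nat)
    (u : R -> 'rV[R]_n) (K : R) :
  (forall s t, 0 <= s -> 0 <= t -> `|u t - u s| <= K * `|t - s|) ->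
  exists2 B, 0 <= B & forall t, 0 < t -> `|derive1 u t| <= B.
Proof.
move=> ulip; have K0 : 0 <= K.
  by have := ulip 0 1 (lexx _) ler01; rewrite subr0 normr1 mulr1;
    apply: le_trans.
exists (K + `|point : 'rV[R]_n|); first exact: addr_ge0.
move=> t t0; rewrite derive1E.
have [dt|ndt] := pselect (derivable u t 1); last first.
  by rewrite /derive dvgP// lerDr.
apply: (@le_trans _ _ K); last by rewrite lerDl.
have : `|h^-1 *: ((u \o shift t) (h *: 1) - u t)| @[h --> 0^'] --> `|'D_1 u t|.
  exact: cvg_norm.
move=> /cvg_lim <-//; apply: limr_le; first by apply: is_cvg_norm.
near=> h; rewrite normrZ /= [h *: 1]mulr1.
have h0 : h != 0 by near: h; exact: nbhs_dnbhs_neq.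
have ht : `|h| < t by near: h; exact: dnbhs0_lt.
have htp : 0 <= h + t by have := lerNnormlW (lexx `|h|); lra.
rewrite normfV mulrC ler_pdivrMr ?normr_gt0//.
by apply: (le_trans (ulip _ _ (ltW t0) htp)); rewrite addrK.
Unshelve. all: by end_near. Qed.

(** * Smooth bumps converging to the indicator of an interval *)

Section PointwiseDerive.
Context (R : realType) (f g : R -> R) (x df dg : R).
Hypothesis (hf : is_derive x 1 f df) (hg : is_derive x 1 g dg).

Lemma is_derive_add : is_derive x 1 (fun y => f y + g y) (df + dg).
Proof. exact: (is_deriveD hf hg). Qed.

Lemma is_derive_mul :
  is_derive x 1 (fun y => f y * g y) (f x * dg + g x * df).
Proof. exact: (is_deriveM hf hg). Qed.

Lemma is_derive_scale c : is_derive x 1 (fun y => c * f y) (c * df).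
Proof. exact: (is_deriveZ c hf). Qed.

End PointwiseDerive.

Section Flat.
Context (R : realType).
Implicit Types (p : {poly R}) (x : R).

(** With [p = 1], the classical function that is flat at 0.  The polynomial
    factors make the family stable under differentiation. *)
Definition flat p x : R :=
  if 0 < x then p.[x^-1] * expR (- x^-1) else 0.

(** The exponential of [y = 1 / x] dominates [y ^ (size p + 2)], which leaves
    a factor [x ^ 2]: enough for a vanishing derivative at 0. *)
Lemma flat_small p :
  exists2 M : R, 0 <= M & forall x, 0 < x -> x <= 1 ->
    `|flat p x| <= M * x ^+ 2.
Proof.
pose S := \sum_(i < size p) `|p`_i|; pose m := size p.
have S0 : 0 <= S by exact: sumr_ge0.
exists (S * (m.+2)`!%:R) => [|x x0 x1]; first by rewrite mulr_ge0.
rewrite /flat x0 normrM (ger0_norm (expR_ge0 _)).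
have y1 : 1 <= x^-1 by rewrite invf_ge1.
have y0 : 0 < x^-1 by rewrite invr_gt0.
have pS : `|p.[x^-1]| <= S * x^-1 ^+ m.
  rewrite horner_coef (le_trans (ler_norm_sum _ _ _))// mulr_suml.
  apply: ler_sum => i _; rewrite normrM ler_wpM2l// (ger0_norm (exprn_ge0 _
    (ltW y0))).
  by rewrite ler_weXn2l// ltnW.
have eE : x^-1 ^+ m.+2 / m.+2`!%:R <= expR x^-1.
  by apply: (le_trans _ (expR_ge1Dxn m.+1 (ltW y0))); rewrite lerDr.
have f0 : (0 : R) < m.+2`!%:R by rewrite ltr0n fact_gt0.
rewrite expRN; apply: (@le_trans _ _ (S * x^-1 ^+ m / (x^-1 ^+ m.+2 /
  m.+2`!%:R))).
  apply: ler_pM => //.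
  by rewrite lef_pV2// posrE ?expR_gt0// divr_gt0// exprn_gt0.
have Y0 : x^-1 ^+ m != 0 by rewrite expf_neq0// gt_eqF.
rewrite -{3}(invrK x) -[m.+2]addn2 exprD.
move: (x^-1 ^+ m) (x^-1) Y0 y0 (gt_eqF f0) => Y y Y0 y0 f1.
rewrite le_eqVlt; apply/orP; left; apply/eqP; field.
by move: f1; rewrite -[m.+2]addn2 (gt_eqF y0) Y0 => ->.
Qed.

Lemma derive1_flat p x : is_derive x 1 (flat p) (flat ('X^2 * (p - p^`())) x).
Proof.
have [x0|x0|->] := ltgtP x 0.
- rewrite [X in is_derive _ _ _ X]/flat ltNge (ltW x0)/=.
  apply: (@near_eq_is_derive _ _ _ (cst 0)).
  near=> z; rewrite /flat ltNge ltW//=; near: z; exact: lt_nbhsl.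
- rewrite [X in is_derive _ _ _ X]/flat x0.
  apply: (@near_eq_is_derive _ _ _ (fun x => p.[x^-1] * expR (- x^-1))).
    near=> z; rewrite /flat ifT//; near: z; exact: lt_nbhsr.
  have xx : is_derive x 1 (fun y : R => y^-1) (- x ^- 2).
    apply: is_derive_eq; first by apply: (@is_deriveV _ id); rewrite ?gt_eqF.
    by rewrite -[LHS]/(_ * _) mulr1.
  have p' : is_derive x 1 (fun y => p.[y^-1]) (p^`().[x^-1] * (- x^-2)).
    exact: (@is_derive1_comp _ (horner p) (fun y => y^-1)).
  have e' : is_derive x 1 (fun y => expR (- y^-1)) (expR (- x^-1) * (x^-2)).
    apply: (@is_derive1_comp _ expR (fun y => - y^-1)).
    by rewrite -[x^-2]opprK; exact: is_deriveN.
  apply: (is_derive_eq (is_derive_mul p' e')).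
  by rewrite hornerM hornerXn hornerD hornerN; field; rewrite gt_eqF.
- rewrite [X in is_derive _ _ _ X]/flat ltxx.
  have [M M0 HM] := flat_small p.
  have F0 : flat p 0 = 0 by rewrite /flat ltxx.
  have : h^-1 *: (flat p (h *: 1 + 0) - flat p 0) @[h --> 0^'] --> (0 : R).
    apply/cvgrPdist_lt => e e0; near=> h.
    have h0 : h != 0 by near: h; exact: nbhs_dnbhs_neq.
    have he : `|h| < e / (M + 1).
      near: h; apply: dnbhs0_lt; by rewrite divr_gt0// ltr_wpDl.
    have h1 : `|h| < 1 by near: h; exact: dnbhs0_lt.
    rewrite F0 sub0r normrN subr0 addr0 -![_ *: _]/(_ * _) mulr1.
    have [hp|hn] := ltP 0 h; last by rewrite /flat [0 < h]ltNge hn/= mulr0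
      normr0.
    rewrite gtr0_norm// in he h1.
    rewrite normrM gtr0_norm ?invr_gt0// mulrC ltr_pdivrMr//.
    apply: (le_lt_trans (HM h hp (ltW h1))); rewrite expr2 mulrA ltr_pM2r//.
    apply: (@le_lt_trans _ _ ((M + 1) * h)); first by rewrite ler_pM2r// lerDl.
    by rewrite mulrC -ltr_pdivlMr// ltr_wpDl.
  move=> H; apply: DeriveDef; first exact: cvgP H.
  exact: cvg_lim H.
Unshelve. all: by end_near. Qed.

Lemma flat_ge0 x : 0 <= flat 1 x.
Proof. by rewrite /flat; case: ifP => // _; rewrite hornerC mul1r expR_ge0. Qed.

Lemma flat_le1 x : flat 1 x <= 1.
Proof.
rewrite /flat; case: ifP => // x0.
by rewrite hornerC mul1r -expR0 ler_expR oppr_le0 invr_ge0 ltW.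
Qed.

Lemma flat_neg p x : x <= 0 -> flat p x = 0.
Proof. by rewrite /flat ltNge => ->. Qed.

Lemma cvg_flat x : 0 < x -> flat 1 (m.+1%:R * x) @[m --> \oo] --> (1 : R).
Proof.
move=> x0.
have -> : (fun m => flat 1 (m.+1%:R * x)) = (fun m => expR (- (m.+1%:R^-1 *
  x^-1))).
  apply/funext => m; rewrite /flat mulr_gt0// ?ltr0n// hornerC mul1r invfM.
  by [].
have H : - ((m.+1%:R : R)^-1 * x^-1) @[m --> \oo] --> - (0 * x^-1).
  by apply: cvgN; apply: cvgM; [exact: cvg_harmonic|exact: cvg_cst].
rewrite mul0r oppr0 in H.
by rewrite -[X in _ --> X]expR0; apply: continuous_cvg;
  [exact: continuous_expR|exact: H].
Qed.

End Flat.

(** The smallest class that contains the products used as bumps and is closed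
    under differentiation; smoothness of its members is then an induction on
    the order of the derivative. *)
Inductive flat_algebra (R : realType) : (R -> R) -> Prop :=
| flat_algebra_flat p a b : flat_algebra (fun x => flat p (a * x + b))
| flat_algebraD f g : flat_algebra f -> flat_algebra g ->
    flat_algebra (fun x => f x + g x)
| flat_algebraM f g : flat_algebra f -> flat_algebra g ->
    flat_algebra (fun x => f x * g x)
| flat_algebraZ c f : flat_algebra f -> flat_algebra (fun x => c * f x).

Lemma flat_algebra_derive (R : realType) (f : R -> R) : flat_algebra f ->
  exists2 f' : R -> R, flat_algebra f' & forall x : R, is_derive x 1 f (f' x).
Proof.
elim=> [p a b|g h _ [g' Ag' dg] _ [h' Ah' dh]|g h Ag [g' Ag' dg] Ah [h' Ah'
  dh]|c g _ [g' Ag' dg]].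
- exists (fun x => a * flat ('X^2 * (p - p^`())) (a * x + b)).
    by apply: flat_algebraZ; exact: flat_algebra_flat.
  move=> x; have lin : is_derive x 1 (fun y : R => a * y + b) a.
    apply: (is_derive_eq (is_derive_add (is_derive_scale (is_derive_id _ _) a)
      (is_derive_cst b _ _))).
    by rewrite addr0 mulr1.
  rewrite mulrC; apply: (@is_derive1_comp _ (flat p) (fun y => a * y + b)).
  exact: derive1_flat.
- exists (fun x => g' x + h' x); first exact: flat_algebraD.
  by move=> x; exact: is_derive_add.
- exists (fun x => g x * h' x + h x * g' x).
    by apply: flat_algebraD; apply: flat_algebraM.
  by move=> x; exact: is_derive_mul.
- exists (fun x => c * g' x); first exact: flat_algebraZ.
  by move=> x; exact: is_derive_scale.
Qed.

Lemma flat_algebra_smooth (R : realType) (f : R -> R) : flat_algebra f ->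
  forall k x, derivable (derive1n k f) x 1.
Proof.
move=> Af k; suff : flat_algebra (derive1n k f).
  by move=> /flat_algebra_derive[g _ dg] x; have [] := dg x.
elim: k => [//|k /flat_algebra_derive[g Ag dg]].
suff -> : derive1n k.+1 f = g by [].
apply/funext => x; rewrite /derive1n iterS -/(derive1n k f) derive1E.
by have [_] := dg x.
Qed.

(** Positive exactly on ]a, b[, and steeper at both ends as [m] grows. *)
Definition bump (R : realType) (a b : R) (m : nat) (x : R) : R :=
  flat 1 (m.+1%:R * (x - a)) * flat 1 (m.+1%:R * (b - x)).

Lemma bump_out (R : realType) (a b : R) m x : x \notin `[a, b] ->
  bump a b m x = 0.
Proof.
rewrite in_itv/= negb_and -!ltNge /bump => /orP[xa|bx].
  by rewrite flat_neg ?mul0r// mulr_ge0_le0// subr_le0 ltW.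
by rewrite [X in _ * X]flat_neg ?mulr0// mulr_ge0_le0// subr_le0 ltW.
Qed.

Lemma bump_flat_algebra (R : realType) (a b : R) m : flat_algebra (bump a b m).
Proof.
have -> : bump a b m = fun x => flat 1 (m.+1%:R * x + - (m.+1%:R * a)) *
    flat 1 (- m.+1%:R * x + m.+1%:R * b).
  by apply/funext => x; rewrite /bump mulrBr mulrBr mulNr (addrC (- _)).
by apply: flat_algebraM; exact: flat_algebra_flat.
Qed.

Lemma bump_test (R : realType) (a b T : R) m : 0 < a -> a <= b -> b < T ->
  test_function T (bump a b m).
Proof.
move=> a0 ab bT; split; last by exists a, b; split => // x; exact: bump_out.
exact/flat_algebra_smooth/bump_flat_algebra.
Qed.

Lemma bump_continuous (R : realType) (a b : R) m : continuous (bump a b m).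
Proof.
move=> x; apply: differentiable_continuous; apply/derivable1_diffP.
exact: (@flat_algebra_smooth _ _ (bump_flat_algebra a b m) 0%N x).
Qed.

Lemma bump_bound (R : realType) (a b : R) m x : 0 <= bump a b m x <= 1.
Proof.
by rewrite /bump mulr_ge0 ?flat_ge0//= mulr_ile1 ?flat_ge0 ?flat_le1.
Qed.

Lemma cvg_bump (R : realType) (a b x : R) :
  bump a b m x @[m --> \oo] --> (\1_(`]a, b[%classic : set R) x : R).
Proof.
rewrite indicE; case: (boolP (x \in `]a, b[)) => [xab|xab].
  rewrite mem_set//= -[1%:R]mulr1.
  move: xab; rewrite in_itv/= => /andP[ax xb].
  by apply: cvgM; apply: cvg_flat; rewrite subr_gt0.
rewrite memNset/=; last exact/negP.
suff -> : (fun m => bump a b m x) = fun=> 0 by exact: cvg_cst.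
apply/funext => m; move: xab; rewrite in_itv/= negb_and -!leNgt /bump =>
  /orP[xa|bx].
  by rewrite flat_neg ?mul0r// mulr_ge0_le0// subr_le0.
by rewrite [X in _ * X]flat_neg ?mulr0// mulr_ge0_le0// subr_le0.
Qed.

(** * Integration with respect to the Lebesgue measure *)

(** Domination in the form used for real-valued functions on the line. *)
Lemma integrable_le (R : realType) (D : set R) (f g : R -> R) :
  measurable D -> measurable_fun D f -> (forall x, D x -> `|f x| <= g x) ->
  mu.-integrable D (EFin \o g) -> mu.-integrable D (EFin \o f).
Proof.
move=> mD mf fg ig; apply: (@le_integrable _ _ _ mu _ mD _ (EFin \o g)) => //.
  exact/measurable_EFinP.
by move=> x Dx; rewrite /= lee_fin (le_trans (fg x Dx))// ler_norm.
Qed.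

Lemma ae_imply (R : realType) (P Q : R -> Prop) :
  {ae (@lebesgue_measure R), forall t, P t} -> (forall t, P t -> Q t) ->
  {ae (@lebesgue_measure R), forall t, Q t}.
Proof.
move=> [N [mN N0 sN]] PQ; exists N; split=> // t nQ; apply: sN => Pt.
by apply: nQ; exact: PQ.
Qed.

Section AeLebesgue.
Context (R : realType).
Implicit Types (D : set (measurableTypeR R)) (f g : R -> R).

Lemma ae_integrable D f g : measurable D ->
  mu.-integrable D (EFin \o f) -> measurable_fun D g ->
  {ae mu, forall t, D t -> f t = g t} -> mu.-integrable D (EFin \o g).
Proof.
move=> mD /integrableP[mf fi] mg fg; apply/integrableP; split.
  exact/measurable_EFinP.
apply: le_lt_trans fi; rewrite le_eqVlt; apply/orP; left; apply/eqP.
apply: ae_eq_integral => //.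
- by apply: measurableT_comp => //; exact/measurable_EFinP.
- exact: measurableT_comp.
- by apply: (ae_imply fg) => t E Dt; rewrite /= E.
Qed.

Lemma ae_Rintegral D f g : measurable D ->
  measurable_fun D f -> measurable_fun D g ->
  {ae mu, forall t, D t -> f t = g t} ->
  \int[mu]_(t in D) f t = \int[mu]_(t in D) g t.
Proof.
move=> mD mf mg fg; rewrite /Rintegral; congr fine.
apply: ae_eq_integral => //.
- exact/measurable_EFinP.
- exact/measurable_EFinP.
- by apply: (ae_imply fg) => t E Dt; rewrite /= E.
Qed.

Lemma integrable_measurable D f : mu.-integrable D (EFin \o f) ->
  measurable_fun D f.
Proof. by move=> /measurable_int/measurable_EFinP. Qed.

Lemma integrable_lin D f g (a : R) : measurable D ->
  mu.-integrable D (EFin \o f) -> mu.-integrable D (EFin \o g) ->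
  mu.-integrable D (EFin \o (fun t => a * f t + g t)).
Proof.
move=> mD fi gi.
have -> : EFin \o (fun t => a * f t + g t) =
  (fun t => a%:E * (EFin \o f) t)%E \+ (EFin \o g) by [].
by apply: integrableD => //; exact: integrableZl.
Qed.

Lemma Rintegral_lin D f g (a : R) : measurable D ->
  mu.-integrable D (EFin \o f) -> mu.-integrable D (EFin \o g) ->
  \int[mu]_(t in D) (a * f t + g t) =
  a * \int[mu]_(t in D) f t + \int[mu]_(t in D) g t.
Proof.
move=> mD fi gi; rewrite RintegralD ?RintegralZl//.
exact: (integrableZl mD a fi).
Qed.

Lemma Rintegral_restrict D D' f : D `<=` D' ->
  (forall t, D' t -> ~ D t -> f t = 0) ->
  \int[mu]_(t in D') f t = \int[mu]_(t in D) f t.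
Proof.
move=> DD' f0; rewrite Rintegral_mkcond [RHS]Rintegral_mkcond.
apply: eq_Rintegral => t _; rewrite !patchE.
have [Dt|nDt] := pselect (D t).
  by rewrite !mem_set//; exact: DD'.
rewrite (memNset nDt); have [D't|nD't] := pselect (D' t).
  by rewrite mem_set// f0.
by rewrite memNset.
Qed.

End AeLebesgue.

(** The max norm is dominated by the sum of the absolute values of the
    coordinates. *)
Lemma norm_integrable (R : realType) (n : nat)
    (D : set (measurableTypeR R)) (v : R -> 'rV[R]_n) :
  measurable D ->
  (forall i, mu.-integrable D (EFin \o (fun t => v t ord0 i))) ->
  mu.-integrable D (EFin \o (fun t => `|v t|)).
Proof.
move=> mD vi.
have si : mu.-integrable D (EFin \o (fun t => \sum_(i < n) `|v t ord0 i|)).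
  have := @integrable_sum _ _ _ mu D mD _ (index_enum 'I_n) xpredT
    (fun i t => `|v t ord0 i|%:E) (fun i _ => integrable_norm (vi i)).
  by apply: eq_integrable => // t _; rewrite /= sumEFin.
apply: (integrable_le _ _ _ si) => //.
  have mv i : measurable_fun D (fun t => `|v t ord0 i|).
    by apply: measurableT_comp => //; exact: integrable_measurable (vi i).
  have -> : (fun t => `|v t|) = fun t => \big[Num.max/0]_(i < n) `|v t ord0 i|.
    apply/funext => t; apply/eqP; rewrite eq_le; apply/andP; split.
      by apply: norm_le_coord => [|i];
        [exact: bigmax_ge_id|exact: (le_bigmax _ (fun i => `|v t ord0 i|))].
    by apply: bigmax_le => // i _; exact: coord_le_norm.
  elim: (index_enum 'I_n) => [|i r IH].
    by under eq_fun do rewrite big_nil; exact: measurable_cst.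
  by under eq_fun do rewrite big_cons; exact: (measurable_maxr (mv i) IH).
move=> t _; rewrite normr_id; apply: norm_le_coord => [|i];
  first exact: sumr_ge0.
by rewrite (bigD1 i)//= lerDl; exact: sumr_ge0.
Qed.

(** * Uniqueness and gluing of weak derivatives *)

Section DuBoisReymond.
Context (R : realType) (T : R) (g : R -> R).
Hypothesis gint : mu.-integrable `]0, T[ (EFin \o g).
Hypothesis g0 : forall h, test_function T h ->
  \int[mu]_(t in `]0, T[) (g t * h t) = 0.

Let mT : measurable (`]0, T[%classic : set (measurableTypeR R)).
Proof. exact: measurable_itv. Qed.

(** Dominated convergence along the bumps. *)
Lemma interval_integral0 a b : 0 < a -> a <= b -> b < T ->
  \int[mu]_(t in `]a, b[) g t = 0.
Proof.
move=> a0 ab bT.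
have mg : measurable_fun `]0, T[ g by apply/measurable_EFinP;
  exact: measurable_int gint.
have mb m : measurable_fun `]0, T[ (bump a b m).
  by apply: measurable_funTS; apply: continuous_measurable_fun;
    exact: bump_continuous.
pose F := fun (m : nat) t => (g t * bump a b m t)%:E.
pose G := fun t => (g t * \1_(`]a, b[%classic : set R) t)%:E.
have mF m : measurable_fun `]0, T[ (F m) by apply/measurable_EFinP;
  exact: measurable_funM.
have mG : measurable_fun `]0, T[ G.
  by apply/measurable_EFinP; apply: measurable_funM => //;
    apply: measurable_indic; exact: measurable_itv.
have FG : {ae mu, forall t, (`]0, T[%classic : set R) t ->
  F ^~ t @ \oo --> G t}.
  apply: aeW => t _; apply: cvg_EFin; first by exact: nearW.
  by apply: cvgM; [exact: cvg_cst | exact: cvg_bump].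
have FB : {ae mu, forall t (m : nat), (`]0, T[%classic : set R) t ->
  (`|F m t| <= (`|g t|)%:E)%E}.
  apply: aeW => t m _; rewrite /F /= lee_fin normrM ler_piMr//.
  by have /andP[h0 h1] := bump_bound a b m t; rewrite ger0_norm.
have [_ _ cv] := dominated_convergence (mu :=
  mu) mT mF mG FG (integrable_norm gint) FB.
have F0 m : (\int[mu]_(t in `]0%R, T[) F m t = 0)%E.
  have := g0 (bump_test m a0 ab bT); rewrite /Rintegral => F0.
  have iF : mu.-integrable `]0, T[ (F m).
    apply: (@integrable_le _ _ _ (fun t => `|g t|)) (integrable_norm gint) =>
      //.
      exact: measurable_funM.
    move=> t _; rewrite normrM ler_piMr//.
    by have /andP[h0 h1] := bump_bound a b m t; rewrite ger0_norm.
  by rewrite -(fineK (integrable_fin_num mT iF)) F0.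
have : (\int[mu]_(t in `]0%R, T[) G t = 0)%E.
  move: cv; set I := (X in X @ _ --> _).
  have -> : I = cst 0%E by apply/funext => m; exact: F0.
  by move=> cv; apply: (cvg_unique _ cv);
    [exact: ereal_hausdorff|exact: cvg_cst].
move=> G0; rewrite /Rintegral -[RHS]/(fine 0%E) -G0; congr fine.
have -> : `]a, b[%classic = `]0%R, T[ `&` `]a, b[ :> set R.
  rewrite setIidr// => t /=; rewrite !in_itv/= => /andP[? ?].
  by apply/andP; split; lra.
rewrite integral_mkcondr; apply: eq_integral => t _.
by rewrite /G /patch indicE; case: (t \in _); rewrite ?mulr1 ?mulr0.
Qed.

(** The primitive of [g] is constant on ]0, T[, and its derivative is a.e.
    equal to [g]. *)
Lemma du_bois_reymond : {ae mu, forall t, 0 < t < T -> g t = 0}.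
Proof.
pose G := g \_ (`]0, T[%classic : set R).
have GE t : 0 < t < T -> G t = g t.
  by move=> tT; rewrite /G patchE mem_set//= in_itv.
have iG : mu.-integrable setT (EFin \o G).
  have := (integrable_mkcond _ mT).1 gint.
  by apply: eq_integrable => // t _; rewrite /G /= restrict_EFin.
have iGy y : mu.-integrable `]-oo, y] (EFin \o G).
  by apply: integrableS iG => //; exact: measurable_itv.
have := FTC1Ny iGy (integrable_locally mT gint).
apply: filterS; first exact: (ae_filter_ringOfSetsType mu).
move=> t [_ dF] tT; rewrite -(GE t tT) -dF.
set F := fun x => _.
have Fc s : 0 < s < T -> F s = F t.
  move=> sT; wlog st : s t sT tT {dF} / t <= s.
    move=> W; have [ts|/ltW st] := leP t s; first exact: W.
    by apply/esym; apply: W.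
  apply/eqP; rewrite -subr_eq0 /F Rintegral_itvB ?bnd_simp//.
  have -> : \int[mu]_(x in `]t, s]) G x = \int[mu]_(x in `]t, s[) G x.
    apply/esym; apply: Rintegral_itv_bndo_bndc; apply: integrableS iG => //;
      exact: measurable_itv.
  move/andP: sT => [s0 sT]; move/andP: tT => [t0 tT].
  rewrite -(interval_integral0 t0 st sT); apply/eqP/eq_Rintegral => x.
  rewrite inE/= in_itv/= => /andP[tx xs]; apply: GE; apply/andP; split; lra.
rewrite derive1E -(derive_cst (F t) t 1); apply: near_eq_derive.
move/andP: tT => [t0 tT].
near=> s; apply: Fc; apply/andP; split; near: s.
  exact: lt_nbhsr.
exact: lt_nbhsl.
Unshelve. all: by end_near. Qed.

End DuBoisReymond.

Section TestFunctions.
Context (R : realType) (T : R) (h : R -> R).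
Hypothesis hT : test_function T h.

Lemma test_function_continuous : continuous h.
Proof.
move=> x; apply: differentiable_continuous; apply/derivable1_diffP.
by have [H _] := hT; exact: (H 0%N x).
Qed.

Lemma test_function_bounded : exists2 M, 0 <= M & forall x, `|h x| <= M.
Proof.
have [_ [a [b [a0 ab bT h0]]]] := hT.
have [c cab cmax] : exists2 c, c \in `[a, b] & forall t, t \in `[a, b] ->
  `|h t| <= `|h c|.
  apply: (@EVT_max R (fun t => `|h t|) a b ab);
    apply: continuous_subspaceT => t.
  by apply: cvg_norm; exact: test_function_continuous.
exists `|h c| => // x; have [xab|xab] := boolP (x \in `[a, b]);
  first exact: cmax.
by rewrite h0// normr0.
Qed.

Lemma test_function_derive : test_function T (derive1 h).
Proof.
have [H [a [b [a0 ab bT h0]]]] := hT; split.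
  by move=> k x; have := H k.+1 x; rewrite /derive1n iterSr.
exists a, b; split=> // x xab; rewrite derive1E -(derive_cst (0 : R) x (1 : R)).
apply: near_eq_derive.
move: xab; rewrite in_itv/= negb_and -!ltNge => /orP[xa|bx].
  near=> y; apply: h0; rewrite in_itv/= negb_and -!ltNge; apply/orP; left.
  by near: y; exact: lt_nbhsl.
near=> y; apply: h0; rewrite in_itv/= negb_and -!ltNge; apply/orP; right.
by near: y; exact: lt_nbhsr.
Unshelve. all: by end_near. Qed.

Lemma test_function_widen T' : T <= T' -> test_function T' h.
Proof.
have [H [a [b [a0 ab bT h0]]]] := hT => TT'; split=> //.
by exists a, b; split=> //; exact: lt_le_trans TT'.
Qed.

Lemma test_function_out t : ~ (`]0, T[%classic : set R) t -> h t = 0.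
Proof.
have [_ [a [b [a0 ab bT h0]]]] := hT => tT; apply: h0; apply/negP => tab;
  apply: tT.
by move: tab => /=; rewrite !in_itv/= => /andP[? ?]; apply/andP; split; lra.
Qed.

Lemma integrable_test_mul (D : set (measurableTypeR R)) (g : R ->
  R) : measurable D ->
  mu.-integrable D (EFin \o g) ->
  mu.-integrable D (EFin \o (fun t => g t * h t)).
Proof.
move=> mD gi; have [M M0 hM] := test_function_bounded.
apply: (@integrable_le _ D _ (fun t => M * `|g t|)) => //.
- apply: measurable_funM; first exact: integrable_measurable.
  by apply: measurable_funTS; apply: continuous_measurable_fun;
    exact: test_function_continuous.
- by move=> t _; rewrite normrM mulrC ler_wpM2r.
- exact: (integrableZl mD M (integrable_norm gi)).
Qed.

End TestFunctions.

(** One coordinate of [weak_derivative_on], to which it is definitionally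
    equal. *)
Definition scalar_weak_derivative (R : realType) (T : R) (v dv : R -> R) :=
  [/\ mu.-integrable `]0, T[ (EFin \o v), mu.-integrable `]0, T[ (EFin \o dv) &
    forall h, test_function T h ->
      \int[mu]_(t in `]0, T[) (v t * derive1 h t) =
      - \int[mu]_(t in `]0, T[) (dv t * h t)].

Section ScalarWeakDerivative.
Context (R : realType).
Implicit Types (T : R) (v w dv dw : R -> R).

Let mI T : measurable (`]0, T[%classic : set (measurableTypeR R)).
Proof. exact: measurable_itv. Qed.

Lemma scalar_weak_derivative_unique T v dv dw :
  scalar_weak_derivative T v dv -> scalar_weak_derivative T v dw ->
  {ae mu, forall t, 0 < t < T -> dv t = dw t}.
Proof.
move=> [vi dvi H] [_ dwi H'].
have gi := integrable_lin (-1) (@mI T) dwi dvi.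
have g0 h : test_function T h ->
    \int[mu]_(t in `]0, T[) ((-1 * dw t + dv t) * h t) = 0.
  move=> th; under eq_Rintegral do rewrite mulrDl -mulrA.
  rewrite Rintegral_lin ?mulN1r//; try exact: (integrable_test_mul th).
  by rewrite -(H' h th) (H h th) addNr.
by apply: (ae_imply (du_bois_reymond gi g0)) => t H0 tT; have := H0 tT; lra.
Qed.

Lemma scalar_weak_derivative_ae T v dv w dw :
  mu.-integrable `]0, T[ (EFin \o w) -> measurable_fun `]0, T[ dw ->
  {ae mu, forall t, 0 < t < T -> v t = w t} ->
  {ae mu, forall t, 0 < t < T -> dv t = dw t} ->
  scalar_weak_derivative T v dv -> scalar_weak_derivative T w dw.
Proof.
move=> wi mdw vw dvdw [vi dvi H].
have dwi : mu.-integrable `]0, T[ (EFin \o dw).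
  by apply: (ae_integrable _ dvi).
have mh h : test_function T h -> measurable_fun (`]0, T[ :
  set (measurableTypeR R)) h.
  by move=> th; apply: measurable_funTS; apply: continuous_measurable_fun;
    exact: test_function_continuous th.
split=> // h th; have th' := test_function_derive th.
transitivity (\int[mu]_(t in `]0, T[) (v t * derive1 h t)).
  apply: ae_Rintegral => //.
  - by apply: measurable_funM; [exact: integrable_measurable|exact: mh].
  - by apply: measurable_funM; [exact: integrable_measurable|exact: mh].
  - apply: (ae_imply vw).
    by move=> t + /=; rewrite in_itv/= => E tT; rewrite E.
rewrite H//; congr (- _); apply: ae_Rintegral => //.
- by apply: measurable_funM; [exact: integrable_measurable|exact: mh].
- by apply: measurable_funM; [exact: integrable_measurable|exact: mh].
- apply: (ae_imply dvdw).
  by move=> t + /=; rewrite in_itv/= => E tT; rewrite E.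
Qed.

Lemma scalar_weak_derivative_lin T (a : R) v dv w dw :
  scalar_weak_derivative T v dv -> scalar_weak_derivative T w dw ->
  scalar_weak_derivative T (fun t => a * v t + w t) (fun t => a * dv t + dw t).
Proof.
move=> [vi dvi H] [wi dwi H']; split; try exact: integrable_lin.
move=> h th; have th' := test_function_derive th.
under eq_Rintegral do rewrite mulrDl -mulrA.
rewrite Rintegral_lin//; try exact: (integrable_test_mul th').
under [in RHS]eq_Rintegral do rewrite mulrDl -mulrA.
rewrite [in RHS]Rintegral_lin//; try exact: (integrable_test_mul th).
by rewrite H// H'// opprD mulrN.
Qed.

Lemma scalar_weak_derivative_restrict T T' v dv : T <= T' ->
  scalar_weak_derivative T' v dv -> scalar_weak_derivative T v dv.
Proof.
move=> TT' [vi dvi H].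
have sub : (`]0, T[ : set (measurableTypeR R)) `<=` `]0, T'[.
  by move=> t/=; rewrite !in_itv/= => /andP[-> tT]; exact: lt_le_trans TT'.
split; [exact: integrableS vi|exact: integrableS dvi|].
move=> h th; have th' := test_function_derive th.
have := H h (test_function_widen th TT').
rewrite (Rintegral_restrict sub); last first.
  by move=> t _ nt; rewrite (test_function_out th' nt) mulr0.
move=> ->; congr (- _); apply: (Rintegral_restrict sub).
by move=> t _ nt; rewrite (test_function_out th nt) mulr0.
Qed.

End ScalarWeakDerivative.

(** At [t] use the weak derivative on the shortest interval ]0, k + 1[ of
    integral length that contains [t].  By uniqueness it agrees a.e. with the
    weak derivative on any longer one, so the result is a weak derivative on
    all of them. *)
Lemma scalar_weak_derivative_glue (R : realType) (v : R -> R) :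
  (forall T, 0 < T -> exists dv, scalar_weak_derivative T v dv) ->
  exists dv, forall T, 0 < T -> scalar_weak_derivative T v dv.
Proof.
move=> H.
have /choice[d Hd] : forall k : nat,
    exists dv, scalar_weak_derivative k.+1%:R v dv.
  by move=> k; exact: H.
pose dv t := d (Num.truncn t) t; exists dv => T T0.
pose M := Num.truncn T.
have TM : T <= M.+1%:R by exact/ltW/truncnS_gt.
apply: (scalar_weak_derivative_restrict TM).
have [vi dMi _] := Hd M.
have mdv : measurable_fun (`]0, M.+1%:R[ : set (measurableTypeR R)) dv.
  pose E k : set (measurableTypeR R) := `]0, M.+1%:R[ `&` `[k%:R, k.+1%:R[.
  have mE k : measurable (E k) by apply: measurableI; exact: measurable_itv.
  have -> : `]0, M.+1%:R[%classic = \bigcup_k E k.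
    apply/seteqP; split => t /=.
      move=> tM; exists (Num.truncn t) => //; split=> //=.
      rewrite in_itv/=; apply: truncn_itv.
      by move: tM; rewrite in_itv/= => /andP[/ltW].
    by move=> [k _ []].
  apply/(measurable_fun_bigcup _ mE) => k.
  apply: (eq_measurable_fun (d k)).
    move=> t /set_mem[_ /=]; rewrite in_itv/= => kt.
    by rewrite /dv (truncn_def kt).
  have [_ /integrable_measurable mdk _] := Hd k.
  apply: measurable_funS mdk; first exact: measurable_itv.
  by move=> t [/=]; rewrite !in_itv/= => /andP[-> _] /andP[_ ->].
apply: (scalar_weak_derivative_ae vi mdv _ _ (Hd M)); first by apply: aeW.
have dk (k : nat) : {ae mu, forall t, (k <= M)%N -> 0 < t < k.+1%:R ->
  d M t = d k t}.
  have [kM|Mk] := leqP k M; last by apply: aeW.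
  have HM : scalar_weak_derivative k.+1%:R v (d M).
    by apply: scalar_weak_derivative_restrict (Hd M); rewrite ler_nat.
  by apply: (ae_imply (scalar_weak_derivative_unique HM (Hd k))).
apply: (ae_imply (ae_foralln dk)) => t Ht /andP[t0 tM].
apply: Ht; first by rewrite truncn_le_nat.
by rewrite t0 truncnS_gt.
Qed.

Lemma W11loc_weak_derivative (R : realType) (n : nat) (v : R -> 'rV[R]_n) :
  W11loc v -> exists dv, weak_derivative v dv.
Proof.
move=> Hv; have /choice[d Hd] : forall i : 'I_n, exists dv, forall T, 0 < T ->
    scalar_weak_derivative T (fun t => v t ord0 i) dv.
  move=> i; apply: scalar_weak_derivative_glue => T T0.
  by have [dv Hdv] := Hv T T0; exists (fun t => dv t ord0 i); exact: Hdv.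
exists (fun t => \row_i d i t) => T T0 i.
have := Hd i T T0; congr (scalar_weak_derivative _ _ _).
by apply/funext => t; rewrite mxE.
Qed.

Section VectorWeakDerivative.
Context (R : realType) (n : nat).
Implicit Types v dv w dw : R -> 'rV[R]_n.

(** The coordinates are indexed by natural numbers in order to merge their
    exceptional sets into one null set. *)
Lemma weak_derivative_unique v w dv dw :
  weak_derivative v dv -> weak_derivative w dw ->
  {ae mu, forall t, 0 < t -> v t = w t} ->
  forall T, 0 < T -> {ae mu, forall t, 0 < t < T -> dv t = dw t}.
Proof.
move=> vdv wdw vw T T0.
have ei (i : 'I_n) : {ae mu, forall t, 0 < t < T -> dv t ord0 i = dw t ord0 i}.
  have wdwi : scalar_weak_derivative T (fun t => w t ord0 i)
    (fun t => dw t ord0 i) := wdw T T0 i.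
  have vdvi : scalar_weak_derivative T (fun t => v t ord0 i)
    (fun t => dv t ord0 i) := vdv T T0 i.
  have [wi _ _] := wdwi; have [_ dvi _] := vdvi.
  apply: scalar_weak_derivative_unique wdwi.
  apply: (scalar_weak_derivative_ae wi (integrable_measurable dvi) _ _ vdvi).
    by apply: (ae_imply vw) => t E /andP[t0 _]; rewrite E.
  by apply: aeW.
have all : {ae mu, forall t, forall i : nat, forall j : 'I_n, val j = i ->
    0 < t < T -> dv t ord0 j = dw t ord0 j}.
  apply: ae_foralln => i; have [ni|ni] := ltnP i n.
    apply: (ae_imply (ei (Ordinal ni))) => t E j ji.
    by have -> : j = Ordinal ni by exact: val_inj.
  by apply: aeW => t j ji; move: ni; rewrite -ji leqNgt ltn_ord.
apply: (ae_imply all) => t E tT; apply/rowP => i.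
exact: (E i i).
Qed.

Lemma wderivP v : W11loc v -> weak_derivative v (wderiv v).
Proof. by move=> /W11loc_weak_derivative ex; exact: (xgetPex (fun=> 0) ex). Qed.

Lemma weak_derivative_lin (a : R) v w dv dw :
  weak_derivative v dv -> weak_derivative w dw ->
  weak_derivative (fun t => a *: v t + w t) (fun t => a *: dv t + dw t).
Proof.
move=> vdv wdw T T0 i.
have := scalar_weak_derivative_lin a (vdv T T0 i) (wdw T T0 i).
by congr (scalar_weak_derivative _ _ _); apply/funext => t; rewrite !mxE.
Qed.

End VectorWeakDerivative.

(** * The spectral representation as a functional *)

Section Spectral.
Context (R : realType) (n : nat) (u : R -> 'rV[R]_n) (S B : R).
Hypothesis S0 : 0 < S.
Hypothesis B0 : 0 <= B.
Hypothesis mu' : forall i,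
  measurable_fun (`[0, +oo[%classic : set (measurableTypeR R))
    (fun t => derive1 u t ord0 i).
Hypothesis u'0 : forall t, S <= t -> derive1 u t = 0.
Hypothesis u'B : forall t, 0 < t -> `|derive1 u t| <= B.
Implicit Types (v dv w dw : R -> 'rV[R]_n).

Let Itv : set (measurableTypeR R) := `]0, S[.
Let Half : set (measurableTypeR R) := `[0, +oo[.
Let mI : measurable Itv. Proof. exact: measurable_itv. Qed.
Let mH : measurable Half. Proof. exact: measurable_itv. Qed.
Let IH : Itv `<=` Half.
Proof. by move=> t; rewrite /Itv /Half /= !in_itv/= andbT => /andP[/ltW]. Qed.
Let C := n%:R * B * (S + 1).
Let C0 : 0 <= C. Proof. by rewrite !mulr_ge0// addr_ge0// ltW. Qed.

Lemma spectral_integrand_bound v dv t : Itv t ->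
  `|spectral_integrand u v dv t| <= C * (`|v t| + `|dv t|).
Proof.
rewrite /Itv /= in_itv/= => /andP[t0 tS]; apply: (le_trans (normr_dotv _ _)).
rewrite /C -!mulrA ler_wpM2l// [leRHS]mulrC.
apply: ler_pM => //; last exact: u'B.
apply: (le_trans (ler_normD _ _)); rewrite normrZ gtr0_norm// mulrC.
have := normr_ge0 (v t); have := normr_ge0 (dv t); nra.
Qed.

Lemma spectral_integrandE v dv t : spectral_integrand u v dv t =
  \sum_(i < n) (t * dv t ord0 i + v t ord0 i) * derive1 u t ord0 i.
Proof. by apply: eq_bigr => i _; rewrite !mxE. Qed.

Section WeakDerivative.
Context (v dv : R -> 'rV[R]_n).
Hypothesis vdv : weak_derivative v dv.

Let vi i : mu.-integrable Itv (EFin \o (fun t => v t ord0 i)).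
Proof. by have [] := vdv S0 i. Qed.

Let dvi i : mu.-integrable Itv (EFin \o (fun t => dv t ord0 i)).
Proof. by have [] := vdv S0 i. Qed.

Let norms_integrable : mu.-integrable Itv (EFin \o (fun t => `|v t| + `|dv t|)).
Proof.
exact: (integrableD mI (norm_integrable mI vi) (norm_integrable mI dvi)).
Qed.

Lemma spectral_integrand_measurable :
  measurable_fun Half (spectral_integrand u v dv).
Proof.
have mloc (g : R -> R) :
    (forall T, 0 < T ->
      measurable_fun (`]0, T[%classic : set (measurableTypeR R)) g) ->
    measurable_fun Half g.
  move=> mg.
  pose E (k : nat) : set (measurableTypeR R) := `]0, k.+1%:R[%classic.
  have mE k : measurable (E k) by exact: measurable_itv.
  have mU : measurable (\bigcup_k E k) by exact: bigcupT_measurable.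
  have -> : Half = [set 0] `|` \bigcup_k E k.
    apply/seteqP; split => t /=; rewrite /Half /= in_itv/= andbT.
      rewrite le_eqVlt => /predU1P[<-|t0]; first by left.
      by right; exists (Num.truncn t) => //=;
        rewrite /E /= in_itv/= t0 truncnS_gt.
    by move=> [->//|[k _]]; rewrite /E /= in_itv/= => /andP[/ltW].
  apply/(measurable_funU _ (measurable_set1 0) mU).
  split; first exact: measurable_fun_set1.
  by apply/(measurable_fun_bigcup _ mE) => k; exact: mg.
have -> : spectral_integrand u v dv = fun t =>
    \sum_(i < n) (t * dv t ord0 i + v t ord0 i) * derive1 u t ord0 i.
  by apply/funext => t; exact: spectral_integrandE.
apply: measurable_sum => i; apply: measurable_funM; last exact: mu'.
apply: measurable_funD; first apply: measurable_funM.
- exact: measurable_funTS.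
- by apply: mloc => T T0; have [_ h _] := vdv T0 i;
  exact: integrable_measurable h.
- by apply: mloc => T T0; have [h _ _] := vdv T0 i;
  exact: integrable_measurable h.
Qed.

Lemma spectral_integrand_integrable_itv :
  mu.-integrable Itv (EFin \o spectral_integrand u v dv).
Proof.
apply: (@integrable_le _ Itv _ (fun t => C * (`|v t| + `|dv t|))) => //.
- exact: measurable_funS spectral_integrand_measurable.
- by move=> t; exact: spectral_integrand_bound.
- exact: (integrableZl mI C norms_integrable).
Qed.

Let ae_cutoff : {ae mu, forall t, Half t ->
  (spectral_integrand u v dv \_ Itv) t = spectral_integrand u v dv t}.
Proof.
exists [set 0]; split; [exact: measurable_set1|exact: lebesgue_measure_set1|].
move=> t /= nt; apply: contrapT => t0; apply: nt;
  rewrite /Half /= in_itv/= andbT => tge0.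
rewrite patchE; case: ifPn => // /negP ntI.
have St : S <= t.
  rewrite leNgt; apply/negP => tS; apply: ntI; apply: mem_set.
  rewrite /Itv /= in_itv/= tS andbT lt_neqAle tge0 andbT eq_sym; exact/eqP.
by rewrite /spectral_integrand u'0// dotv0.
Qed.

Let cutoff_integrable :
  mu.-integrable Half (EFin \o (spectral_integrand u v dv \_ Itv)).
Proof.
apply: (@integrableS _ _ _ _ setT) => //.
have := (integrable_mkcond _ mI).1 spectral_integrand_integrable_itv.
by apply: eq_integrable => // t _; rewrite /= restrict_EFin.
Qed.

Lemma spectral_integrand_integrable :
  mu.-integrable Half (EFin \o spectral_integrand u v dv).
Proof.
exact: (ae_integrable mH cutoff_integrable spectral_integrand_measurable
  ae_cutoff).
Qed.

(** The flow is at rest after time [S], and the point 0 is negligible. *)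
Lemma spectral_integral_cutoff :
  \int[mu]_(t in Half) spectral_integrand u v dv t =
  \int[mu]_(t in Itv) spectral_integrand u v dv t.
Proof.
rewrite -(ae_Rintegral mH (integrable_measurable cutoff_integrable)
  spectral_integrand_measurable ae_cutoff).
rewrite (Rintegral_restrict IH).
  by apply: eq_Rintegral => t tI; rewrite patchE tI.
by move=> t _ nt; rewrite patchE memNset.
Qed.

(** The right-hand side is a multiple of [W11_seminorm S v] when [dv] is the
    chosen weak derivative: this is the continuity of the functional. *)
Lemma spectral_integral_bound :
  `|\int[mu]_(t in Half) spectral_integrand u v dv t| <=
  C * \int[mu]_(t in Itv) (`|v t| + `|dv t|).
Proof.
rewrite spectral_integral_cutoff -RintegralZl//.
apply: (le_trans (le_normr_Rintegral mI spectral_integrand_integrable_itv)).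
apply: le_Rintegral => //.
- exact: integrable_norm spectral_integrand_integrable_itv.
- exact: (integrableZl mI C norms_integrable).
- by move=> t; exact: spectral_integrand_bound.
Qed.

End WeakDerivative.

(** A.e. equal functions have a.e. equal weak derivatives, so this gives both
    the independence from the choice of weak derivative and the compatibility
    with a.e. equality. *)
Lemma spectral_integral_ae v w dv dw :
  weak_derivative v dv -> weak_derivative w dw ->
  {ae mu, forall t, 0 < t -> v t = w t} ->
  \int[mu]_(t in Half) spectral_integrand u v dv t =
  \int[mu]_(t in Half) spectral_integrand u w dw t.
Proof.
move=> vdv wdw vw; rewrite (spectral_integral_cutoff vdv)
  (spectral_integral_cutoff wdw).
apply: ae_Rintegral => //.
- exact: measurable_funS (spectral_integrand_measurable vdv).
- exact: measurable_funS (spectral_integrand_measurable wdw).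
have dvdw := weak_derivative_unique vdv wdw vw S0.
(* The index b merges the two exceptional sets. *)
have both : {ae mu, forall t, forall b : nat, Itv t ->
  if b is 0%N then v t = w t else dv t = dw t}.
  apply: ae_foralln => -[|k].
    by apply: (ae_imply vw) => t E; rewrite /Itv /= in_itv/= => /andP[t0 _];
      exact: E.
  by apply: (ae_imply dvdw) => t E; rewrite /Itv /= in_itv/=; exact: E.
apply: (ae_imply both) => t E It.
by rewrite /spectral_integrand (E 0%N It) (E 1%N It).
Qed.

Lemma spectral_representationE v dv : weak_derivative v dv ->
  spectral_representation u v =
  - \int[mu]_(t in Half) spectral_integrand u v dv t.
Proof.
move=> vdv; rewrite /spectral_representation; congr (- _).
have vW : W11loc v by move=> T T0; exists dv; exact: vdv.
by apply: (spectral_integral_ae (wderivP vW) vdv); apply: aeW.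
Qed.

Lemma spectral_representation_linear (a : R) v w : W11loc v -> W11loc w ->
  spectral_representation u (fun t => a *: v t + w t) =
  a * spectral_representation u v + spectral_representation u w.
Proof.
move=> /wderivP vdv /wderivP wdw.
rewrite (spectral_representationE (weak_derivative_lin a vdv wdw)).
rewrite (spectral_representationE vdv) (spectral_representationE wdw).
rewrite mulrN -opprD -Rintegral_lin//; try exact: spectral_integrand_integrable.
congr (- _); apply: eq_Rintegral => t _.
rewrite /spectral_integrand -dotvZl -dotvDl; congr dotv.
by rewrite !scalerDr !scalerA mulrC addrACA.
Qed.

Lemma spectral_representation_dual : W11loc_dual (spectral_representation u).
Proof.
split.
- move=> v w /wderivP vdv /wderivP wdw vw.
  rewrite (spectral_representationE vdv) (spectral_representationE wdw).
  by rewrite (spectral_integral_ae vdv wdw vw).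
- exact: spectral_representation_linear.
- move=> v vW e e0; exists [:: S], (e / (C + 1)).
  split; first by rewrite divr_gt0// ltr_wpDl.
    by move=> T; rewrite inE => /eqP ->.
  move=> w wW /(_ S (mem_head _ _)).
  have -> : (fun t => w t - v t) = fun t => -1 *: v t + w t.
    by apply/funext => t; rewrite scaleN1r addrC.
  have zW : W11loc (fun t => -1 *: v t + w t).
    move=> T T0; exists (fun t => -1 *: wderiv v t + wderiv w t).
    exact: (weak_derivative_lin (-1) (wderivP vW) (wderivP wW)).
  rewrite ltr_pdivlMr ?ltr_wpDl// => small; apply: le_lt_trans small.
  have -> : spectral_representation u w - spectral_representation u v =
      spectral_representation u (fun t => -1 *: v t + w t).
    by rewrite spectral_representation_linear// mulN1r addrC.
  rewrite (spectral_representationE (wderivP zW)) normrN.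
  apply: (le_trans (spectral_integral_bound (wderivP zW))).
  rewrite mulrC /W11_seminorm ler_wpM2l ?lerDl//.
  by apply: Rintegral_ge0 => t _; exact: addr_ge0.
Qed.

Lemma spectral_representation_well_definedP :
  spectral_representation_well_defined u.
Proof.
move=> v vW; split; first by exists (wderiv v); exact: wderivP.
move=> dv vdv; split; first exact: spectral_integrand_integrable.
exact: spectral_representationE.
Qed.

End Spectral.

Theorem proposition4 (R : realType) (n : nat) (J : 'rV[R]_n -> R)
    (J_ge0 : forall x, 0 <= J x)
    (J_convex : @convex_function R 'rV[R]_n setT J)
    (J_lsc : lower_semicontinuous (EFin \o J))
    (J_homogeneous : abs_one_homogeneous J)
    (f : 'rV[R]_n) (u : R -> 'rV[R]_n) (u_GF : gradient_flow J f u) :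
  [lipschitz u t | t in `[0, +oo[] /\
  spectral_representation_well_defined u /\
  W11loc_dual (spectral_representation u).
Proof.
have J_sub := seminorm_subadd J_convex J_homogeneous.
split; first exact: (flow_lipschitz_on J_ge0 J_sub J_homogeneous u_GF).
have dist := flow_dist J_ge0 J_sub J_homogeneous u_GF.
have [T T0 [a uT]] := flow_extinction J_ge0 J_sub J_homogeneous u_GF.
have [B B0 u'B] := derive1_lipschitz_bound dist.
have mu' i := @measurable_derive1_lipschitz R n u _ i dist.
have T10 : 0 < T + 1 by lra.
have u'0 t : T + 1 <= t -> derive1 u t = 0.
  move=> Tt; rewrite derive1E -(derive_cst a t (1 : R)); apply: near_eq_derive.
  near=> s; apply: uT; apply/ltW; near: s; apply: lt_nbhsr; lra.
split; first exact: (spectral_representation_well_definedP T10 mu' u'0 u'B).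
exact: (spectral_representation_dual T10 B0 mu' u'0 u'B).
Unshelve. all: by end_near. Qed.
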